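(* Let $n\ge1$, $S=\mathbb{Z}[t_1,\dots,t_{n+1}]$, specialize $t_i=0$ for $i>n+1$, and let $\lambda\in\mathcal{SP}(n)$. Then in $\mathcal{A}_n=S[q][P_1(x|t),\dots,P_{2n}(x|t)]/I_n^{(q)}$, $$P_{1}(x|t)P_\lambda(x|t)\equiv\sum_{\mu\to\lambda,\ \mu\in\mathcal{SP}(n)}P_\mu(x|t)+c_{(1),\lambda}^\lambda(t)P_\lambda(x|t)+q\,P_{\lambda^-}(x|t)\mod I_n^{(q)},$$ where $c_{(1),\lambda}^\lambda(t)=\sum_{i=1}^r t_{\lambda_i+1}$, and the last term is present only when $\lambda_1=n$ and $\lambda_2=n-1$, in which case $\lambda^-=(\lambda_3,\dots,\lambda_{\ell(\lambda)})$.
   Context: $x=(x_1,x_2,\dots)$, $t=(t_1,t_2,\dots)$ indeterminates; $\Gamma'=\mathbb{Z}[P_1(x),P_2(x),\dots]$ (Schur $P$-functions). With $(y|t)^k=(y-t_1)\cdots(y-t_k)$, for a strict partition $\lambda$ of length $\ell\le N$, $P_\lambda(x_1,\dots,x_N|t)=\frac{1}{(N-\ell)!}\sum_{w\in S_N}w\big(\prod_{i=1}^\ell(x_i|t)^{\lambda_i}\prod_{i=1}^\ell\prod_{j=i+1}^N\frac{x_i+x_j}{x_i-x_j}\big)$, and $P_\lambda(x|t)\in\mathbb{Z}[t]\otimes\Gamma'$ is the projective limit over even $N$; $P_i=P_{(i)}$, $P_\emptyset=1$. $\mathcal{SP}(n)$: strict partitions (including $\emptyset$) with $\lambda_1\le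 n$. $\mu\to\lambda$ means $\mu$ is a strict partition obtained from $\lambda$ by adding one box. For $\lambda$ of length $\ell$, $r=2\lfloor(\ell+1)/2\rfloor$ and $\lambda_r:=0$ when $\ell$ is odd. $S[q][P_1(x|t),\dots,P_{2n}(x|t)]$ is the $S[q]$-subalgebra of $S[q]\otimes\Gamma'$ generated by these elements, and $I_n^{(q)}$ is its ideal generated by $P_{n+1}(x|t),\dots,P_{2n-1}(x|t),P_{2n}(x|t)+(-1)^nq$. *)

(* Defs.v *)
From HB Require Import structures.
From mathcomp Require Import all_boot all_order all_fingroup all_algebra.
From mathcomp Require Import mpoly.
From mathcomp Require boolp.
Set Implicit Arguments.
Unset Strict Implicit.
Unset Printing Implicit Defensive.
Import GRing.Theory.
Local Open Scope ring_scope.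

(* Indices are shifted by one throughout: t i stands for t_{i+1}, x i for    *)
(* x_{i+1} and nth 0 la i for lambda_{i+1}.                                  *)

(* (y|t)^k *)
Definition fact_pow (A : comNzRingType) (t : nat -> A) (y : A) (k : nat) : A :=
  \prod_(i < k) (y - t i).

(* The summand of P_la(x_1, ..., x_N | t), before permuting the variables. *)
Definition factP_term (K : fieldType) (t : nat -> K) (la : seq nat) (N : nat)
    (x : 'I_N -> K) : K :=
  \prod_(i < N | (i < size la)%N) fact_pow t (x i) (nth 0%N la i)
  * \prod_(i < N | (i < size la)%N) \prod_(j < N | (i < j)%N)
      ((x i + x j) / (x i - x j)).

(* P_la(x_1, ..., x_N | t); the permutation w acts by x_i |-> x_{w(i)}.  The  *)
(* value 0 for N < l(la) is the one forced by compatibility with truncation  *)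
(* (see factP_fin_stable).                                                   *)
Definition factP_rat (K : fieldType) (t : nat -> K) (la : seq nat) (N : nat)
    (x : 'I_N -> K) : K :=
  if (size la <= N)%N then
    ((N - size la)`!)%:R^-1 * \sum_(w : 'S_N) factP_term t la (x \o w)
  else 0.

(* A sum over S_N of terms depending only on the restriction of w to the      *)
(* first l points is (N - l)! times a sum over injections.                   *)
Section Fiber.
Variables (l N : nat) (lN : (l <= N)%N).
Definition restr_perm_ffun (w : 'S_N) : {ffun 'I_l -> 'I_N} :=
  [ffun i => w (widen_ord lN i)].

Lemma restr_perm_inj (w : 'S_N) : injectiveb (restr_perm_ffun w).
Proof.
apply/injectiveP => i j; rewrite !ffunE => /perm_inj /(congr1 val) /= e.
exact: val_inj.
Qed.

Lemma restr_perm_surj (f : {ffun 'I_l -> 'I_N}) :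
  injectiveb f -> exists w, restr_perm_ffun w = f.
Proof.
move=> /injectiveP f_inj.
pose s := codom f ++ enum [predC codom f].
have s_uniq : uniq s.
  rewrite cat_uniq enum_uniq andbT map_inj_uniq ?enum_uniq //=.
  apply/hasPn => k; rewrite mem_enum inE /=; exact.
have s_size : size s = N.
  rewrite size_cat size_codom -cardE card_ord.
  have := cardC (mem (codom f)); rewrite card_codom // !card_ord => e.
  by rewrite -[RHS]e; congr (_ + _)%N; apply: eq_card.
pose g (i : 'I_N) := nth i s i.
have g_inj : injective g.
  move=> i j; rewrite /g (set_nth_default i) ?s_size // => e.
  by apply/val_inj/eqP; rewrite /= -(nth_uniq i _ _ s_uniq) ?s_size ?e.
exists (perm g_inj); apply/ffunP => i; rewrite ffunE permE /g nth_cat.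
rewrite size_codom card_ord /= ltn_ord.
rewrite (nth_map i) ?size_enum_ord //; congr (f _).
by rewrite nth_ord_enum.
Qed.

Lemma restr_perm_card (f : {ffun 'I_l -> 'I_N}) :
  injectiveb f -> #|[pred w | restr_perm_ffun w == f]| = (N - l)`!.
Proof.
move=> /restr_perm_surj [w0 <-] {f}.
pose B : {set 'I_N} := [set i : 'I_N | (l <= i)%N].
have cB : #|B| = (N - l)%N.
  rewrite cardsE -sum1_card.
  rewrite -(big_mkord (fun i => l <= i)%N (fun=> 1%N)).
  rewrite (@big_cat_nat _ _ _ l) //= [X in (X + _)%N]big_nat_cond big1 => [|i].
    rewrite add0n big_nat_cond (eq_bigl (fun i => (l <= i < N)%N)) => [|i].
      by rewrite -big_nat sum_nat_const_nat muln1.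
    by rewrite andbAC andbb.
  by move=> /andP[/andP[_ h]]; rewrite leqNgt h.
rewrite -cB -card_perm -[RHS](card_imset _ (mulIg w0)); apply: eq_card => w.
rewrite [LHS]inE /=; apply/eqP/imsetP => [/ffunP e|[u]].
  exists (w * w0^-1)%g; last by rewrite mulgKV.
  rewrite unfold_in; apply/subsetP => i; rewrite !inE; apply: contraR.
  rewrite -ltnNge => li; have := e (Ordinal li); rewrite !ffunE.
  have -> : widen_ord lN (Ordinal li) = i by apply: val_inj.
  by rewrite permM => ->; rewrite permK.
move=> uB ->; apply/ffunP => i; rewrite !ffunE permM.
by rewrite (out_perm uB) // inE /= -ltnNge.
Qed.

Lemma sum_restr_perm (Z : nmodType) (F : {ffun 'I_l -> 'I_N} -> Z) :
  \sum_(w : 'S_N) F (restr_perm_ffun w)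
  = (\sum_(f : {ffun 'I_l -> 'I_N} | injectiveb f) F f) *+ (N - l)`!.
Proof.
rewrite (partition_big restr_perm_ffun
  (fun f : {ffun 'I_l -> 'I_N} => injectiveb f)) /=; last first.
  by move=> w _; apply: restr_perm_inj.
rewrite -sumrMnl; apply: eq_bigr => f fi.
rewrite (eq_bigr (fun=> F f)); last by move=> w /eqP ->.
by rewrite sumr_const restr_perm_card.
Qed.
End Fiber.

(* The summand factP_term of w, as a function of the restriction of w. *)
Definition inj_term (K : fieldType) (t : nat -> K) (la : seq nat) (N : nat)
    (x : 'I_N -> K) (f : {ffun 'I_(size la) -> 'I_N}) : K :=
  \prod_(i < size la) fact_pow t (x (f i)) (nth 0%N la i)
  * \prod_(i < size la)
      \prod_(k < N | [forall i' : 'I_(size la), (i' <= i)%N ==> (f i' != k)])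
      ((x (f i) + x k) / (x (f i) - x k)).

Definition inj_sum (K : fieldType) (t : nat -> K) (la : seq nat) (N : nat)
    (x : 'I_N -> K) : K :=
  \sum_(f : {ffun 'I_(size la) -> 'I_N} | injectiveb f) inj_term t x f.

Lemma factP_termE (K : fieldType) (t : nat -> K) la N (x : 'I_N -> K)
    (lN : (size la <= N)%N) (w : 'S_N) :
  factP_term t la (x \o w) = inj_term t x (restr_perm_ffun lN w).
Proof.
rewrite /factP_term /inj_term !big_ord_narrow; congr (_ * _).
  by apply: eq_bigr => i _; rewrite ffunE.
apply: eq_bigr => i _; rewrite [RHS](reindex_inj (@perm_inj _ w)) /=.
apply: eq_big => [j|j _]; last by rewrite ffunE.
apply/idP/forallP => [ij i'|H].
  apply/implyP => i'i; rewrite ffunE (inj_eq perm_inj) -val_eqE /=.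
  by rewrite neq_ltn (leq_ltn_trans i'i ij).
rewrite ltnNge; apply/negP => ji.
have jl : (j < size la)%N by apply: leq_ltn_trans ji _.
have := H (Ordinal jl); rewrite /= ji /= ffunE.
have -> : widen_ord lN (Ordinal jl) = j by apply: val_inj.
by rewrite eqxx.
Qed.

Lemma inj_sum_small (K : fieldType) (t : nat -> K) la N (x : 'I_N -> K) :
  (N < size la)%N -> inj_sum t la x = 0.
Proof.
move=> Nl; rewrite /inj_sum big_pred0 // => f; apply/negP => /injectiveP fi.
by have := max_card (mem (codom f)); rewrite card_codom // !card_ord leqNgt Nl.
Qed.

Lemma factP_ratE (K : fieldType) (t : nat -> K) la N (x : 'I_N -> K) :
  (forall k, k.+1%:R != 0 :> K) -> factP_rat t la x = inj_sum t la x.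
Proof.
move=> ch; rewrite /factP_rat; case: leqP => [lN|Nl]; last first.
  by rewrite inj_sum_small.
under eq_bigr do rewrite (factP_termE t x lN).
rewrite (sum_restr_perm lN (fun f => inj_term t x f)).
rewrite -[X in _ * X]mulr_natl mulKf //.
by case: (_`!) (fact_gt0 (N - size la)) => // k _; apply: ch.
Qed.

Definition vdm (A : comNzRingType) N (x : 'I_N -> A) : A :=
  \prod_(i < N) \prod_(j < N | (i < j)%N) (x i - x j).

Lemma vdm_perm (A : comNzRingType) N (x : 'I_N -> A) (w : 'S_N) :
  vdm (x \o w) = (-1) ^+ w * vdm x.
Proof.
have E (y : 'I_N -> A) : vdm y = \det (Vandermonde N (\row_i - y i)).
  rewrite det_Vandermonde; apply: eq_bigr => i _; apply: eq_bigr => j _.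
  by rewrite !mxE opprK addrC.
rewrite !E -(odd_permV w) -det_perm mulrC -det_mulmx -col_permE.
by congr (\det _); apply/matrixP => i j; rewrite !mxE.
Qed.

Lemma vdm_neq0 (A : idomainType) N (x : 'I_N -> A) : injective x -> vdm x != 0.
Proof.
move=> xi; apply/prodf_neq0 => i _; apply/prodf_neq0 => j ij.
by rewrite subr_eq0 (inj_eq xi) -val_eqE neq_ltn ij.
Qed.

Definition num_term (A : comNzRingType) (t : nat -> A) (la : seq nat) N
    (x : 'I_N -> A) : A :=
  \prod_(i < N | (i < size la)%N) fact_pow t (x i) (nth 0%N la i)
  * (\prod_(i < N | (i < size la)%N) \prod_(j < N | (i < j)%N) (x i + x j)
  * \prod_(i < N | ~~ (i < size la)%N) \prod_(j < N | (i < j)%N) (x i - x j)).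

Lemma num_termE (K : fieldType) (t : nat -> K) la N (x : 'I_N -> K) :
  injective x -> num_term t la x = vdm x * factP_term t la x.
Proof.
move=> xi; rewrite /num_term /factP_term [RHS]mulrCA; congr (_ * _).
rewrite /vdm [X in _ = X * _](bigID (fun i : 'I_N => (i < size la)%N)) /=.
rewrite [RHS]mulrAC; congr (_ * _).
rewrite -big_split /=; apply: eq_bigr => i _.
rewrite -big_split /=; apply: eq_bigr => j ij.
by rewrite mulrC divfK // subr_eq0 (inj_eq xi) -val_eqE neq_ltn ij.
Qed.

Lemma rmorph_num_term (A B : comNzRingType) (phi : {rmorphism A -> B}) t la N
    (x : 'I_N -> A) :
  phi (num_term t la x) = num_term (phi \o t) la (phi \o x).
Proof.
rewrite /num_term !rmorphM !rmorph_prod /=; congr (_ * (_ * _)).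
- apply: eq_bigr => i _; rewrite rmorph_prod; apply: eq_bigr => j _.
  by rewrite rmorphB.
- apply: eq_bigr => i _; rewrite rmorph_prod; apply: eq_bigr => j _.
  by rewrite rmorphD.
- apply: eq_bigr => i _; rewrite rmorph_prod; apply: eq_bigr => j _.
  by rewrite rmorphB.
Qed.

Lemma rmorph_vdm (A B : comNzRingType) (phi : {rmorphism A -> B}) N
    (x : 'I_N -> A) : phi (vdm x) = vdm (phi \o x).
Proof.
rewrite rmorph_prod; apply: eq_bigr => i _; rewrite rmorph_prod.
by apply: eq_bigr => j _; rewrite rmorphB.
Qed.

Lemma num_sum_alt (A : idomainType) (t : nat -> A) la N (x : 'I_N -> A) a b :
  2%:R != 0 :> A -> a != b -> x a = x b ->
  \sum_(w : 'S_N) (-1) ^+ w * num_term t la (x \o w) = 0.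
Proof.
move=> two0 ab xab; set S := \sum_w _.
suff : S = - S.
  by move/eqP; rewrite -addr_eq0 -mulr2n -mulr_natl mulf_eq0 (negPf two0) => /eqP.
rewrite {1}/S (reindex_inj (mulIg (tperm a b))) /= -sumrN; apply: eq_bigr => w _.
rewrite odd_permM odd_tperm ab signr_addb mulrN1 mulNr; congr (- (_ * _)).
have E : x \o (w * tperm a b)%g =1 x \o w.
  by move=> i /=; rewrite permM; case: tpermP => // ->.
rewrite /num_term; congr (_ * (_ * _)).
- by apply: eq_bigr => i _; rewrite E.
- by apply: eq_bigr => i _; apply: eq_bigr => j _; rewrite !E.
- by apply: eq_bigr => i _; apply: eq_bigr => j _; rewrite !E.
Qed.

Section Divisibility.
Variables (R : idomainType) (N : nat).
Local Notation MP := {mpoly R[N]}.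

Definition identify_vars (a b : 'I_N) : MP -> MP :=
  mmap (@mpolyC N R) (fun i => if i == a then 'X_b else 'X_i).

HB.instance Definition _ a b := GRing.RMorphism.on (identify_vars a b).

Lemma identify_varsX a b i :
  identify_vars a b 'X_i = if i == a then 'X_b else 'X_i.
Proof. by rewrite /identify_vars mmapX mmap1U. Qed.

Lemma identify_vars_sub a b (p : MP) :
  exists q, p - identify_vars a b p = ('X_a - 'X_b) * q.
Proof.
have HM (u v : MP) :
  (exists r, u - identify_vars a b u = ('X_a - 'X_b) * r) ->
  (exists r, v - identify_vars a b v = ('X_a - 'X_b) * r) ->
  exists r, u * v - identify_vars a b (u * v) = ('X_a - 'X_b) * r.
  move=> [r1 e1] [r2 e2]; exists (r1 * v + identify_vars a b u * r2).
  rewrite mulrDr mulrA -e1 [('X_a - 'X_b) * (_ * r2)]mulrCA -e2 rmorphM /=.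
  by rewrite mulrBl mulrBr addrA subrK.
have H1 : exists r, 1 - identify_vars a b 1 = ('X_a - 'X_b) * r.
  by exists 0; rewrite rmorph1 subrr mulr0.
elim/mpolyind: p => [|c m p _ _ [q e]].
  by exists 0; rewrite rmorph0 subrr mulr0.
have [r er] : exists r, 'X_[m] - identify_vars a b 'X_[m] = ('X_a - 'X_b) * r.
  rewrite mpolyXE_id; elim/big_rec: _ => // i y _ Hy.
  apply: (HM _ _) => //; elim: (m i) => [|k IH]; first by rewrite expr0.
  rewrite exprS; apply: (HM _ _) => //; rewrite identify_varsX.
  case: eqP => [->|_]; first by exists 1; rewrite mulr1.
  by exists 0; rewrite subrr mulr0.
exists (c *: r + q); rewrite mulrDr -scalerAr -er -e rmorphD /=.
rewrite /identify_vars mmapZ mul_mpolyC scalerBr.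
by rewrite opprD addrACA.
Qed.

Lemma mpolyX_inj : injective (fun i : 'I_N => 'X_i : MP).
Proof.
move=> i j /(congr1 (mcoeff U_(i))); rewrite !mcoeffX eqxx.
case: eqP => [/(congr1 (fun m : 'X_{1..N} => m i))|_ /eqP].
  by rewrite !mnm1E eqxx; case: eqP.
by rewrite oner_eq0.
Qed.

Lemma vdm_dvd (p : MP) :
  (forall a b : 'I_N, (a < b)%N -> identify_vars a b p = 0) ->
  exists q, p = vdm (fun i => 'X_i) * q.
Proof.
move=> H; rewrite /vdm pair_big_dep /=.
pose D (s : seq ('I_N * 'I_N)) : MP := \prod_(ab <- s) ('X_ab.1 - 'X_ab.2).
have key (s : seq ('I_N * 'I_N)) : uniq s ->
    (forall ab, ab \in s -> (ab.1 < ab.2)%N) -> exists q, p = D s * q.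
  elim: s => [|[a b] s IH] /=; first by exists p; rewrite /D big_nil mul1r.
  move=> /andP[abs us] lts.
  have ab : (a < b)%N by apply: (lts (a, b)); rewrite mem_head.
  have {IH us} [|q pE] := IH us.
    by move=> cd cds; apply: lts; rewrite inE cds orbT.
  have /eqP := H a b ab; rewrite pE rmorphM /= mulf_eq0 => /orP[|/eqP q0].
    rewrite rmorph_prod => /eqP h; exfalso; move: h; apply/eqP.
    rewrite prodf_seq_neq0; apply/allP => -[c d] cds /=.
    have cd : (c < d)%N by apply: (lts (c, d)); rewrite inE cds orbT.
    rewrite rmorphB /= !identify_varsX subr_eq0.
    have ne : (c, d) != (a, b) by apply: contraNneq abs => <-.
    case: (eqVneq c a) (eqVneq d a) => [ca|ca] [da|da].
    - by move: cd; rewrite ca da ltnn.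
    - apply: contraNneq ne => /mpolyX_inj bd; by rewrite ca bd.
    - apply: contraTneq cd => /mpolyX_inj ->; rewrite -leqNgt da; exact: ltnW.
    - by apply: contraTneq cd => /mpolyX_inj ->; rewrite ltnn.
  have [r] := identify_vars_sub a b q; rewrite q0 subr0 => rE.
  by exists r; rewrite /D big_cons /= [_ * \prod_(_ <- _) _]mulrC -mulrA -rE.
have [||q pE] := key (enum [pred ab : 'I_N * 'I_N | (ab.1 < ab.2)%N]).
- exact: enum_uniq.
- by move=> ab; rewrite mem_enum.
exists q; rewrite {1}pE; congr (_ * _); rewrite /D big_enum_cond /=.
by apply: eq_bigl => ab; rewrite andbT.
Qed.
End Divisibility.

Section Existence.
Variables (R : idomainType) (chR : forall k, k.+1%:R != 0 :> R).
Variables (t : nat -> R) (la : seq nat) (N : nat).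
Local Notation MP := {mpoly R[N]}.
Local Notation X := (fun i : 'I_N => 'X_i : MP).

Lemma natr_mpoly_neq0 k : k.+1%:R != 0 :> MP.
Proof.
by rewrite -[k.+1%:R](rmorph_nat (@mpolyC N R)) mpolyC_eq0.
Qed.

Let G (w : 'S_N) : MP :=
  (-1) ^+ w * num_term (fun i => (t i)%:MP) la (X \o w).

Lemma G_eval (lN : (size la <= N)%N) (K : fieldType)
    (psi : {rmorphism MP -> K}) w :
  injective (psi \o X) ->
  psi (G w) = vdm (psi \o X) *
    inj_term (fun i => psi (t i)%:MP) (psi \o X) (restr_perm_ffun lN w).
Proof.
move=> inj; rewrite /G rmorphM rmorph_sign rmorph_num_term.
rewrite -factP_termE -[X in num_term _ _ X]/((psi \o X) \o w) num_termE.
  by rewrite vdm_perm !mulrA -signr_addb addbb mul1r.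
by move=> i j /inj /perm_inj.
Qed.

Lemma factP_poly_ex : exists p : MP,
  forall (K : fieldType) (psi : {rmorphism MP -> K}), injective (psi \o X) ->
  psi p = inj_sum (fun i => psi (t i)%:MP) la (psi \o X).
Proof.
have [Nl|lN] := ltnP N (size la).
  by exists 0 => K psi _; rewrite rmorph0 inj_sum_small.
pose rep (f : {ffun 'I_(size la) -> 'I_N}) : 'S_N :=
  odflt 1%g [pick w | restr_perm_ffun lN w == f].
have repP (f : {ffun 'I_(size la) -> 'I_N}) :
    injectiveb f -> restr_perm_ffun lN (rep f) = f.
  move=> /(restr_perm_surj lN)[w wE]; rewrite /rep; case: pickP => [w' /eqP //|].
  by move=> /(_ w); rewrite wE eqxx.
have tX_inj : injective (@FracField.tofrac MP \o X).
  by move=> i j /= /eqP; rewrite tofrac_eq => /eqP /mpolyX_inj.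
have GE w : G w = G (rep (restr_perm_ffun lN w)).
  apply/eqP; rewrite -tofrac_eq; apply/eqP.
  by rewrite !(G_eval lN) // repP ?restr_perm_inj.
pose A : MP := \sum_(f : {ffun 'I_(size la) -> 'I_N} | injectiveb f) G (rep f).
have AE : \sum_w G w = A *+ (N - size la)`!.
  rewrite (eq_bigr _ (fun w _ => GE w)).
  exact: (sum_restr_perm lN (fun f => G (rep f))).
have [p pE] : exists p, A = vdm X * p.
  apply: vdm_dvd => a b ab.
  have /(congr1 (identify_vars a b)) := AE.
  rewrite rmorph_sum rmorphMn /= -[RHS]mulr_natl.
  under eq_bigr do rewrite rmorphM rmorph_sign rmorph_num_term.
  rewrite (@num_sum_alt _ _ _ _ (identify_vars a b \o X) a b) ?natr_mpoly_neq0 //.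
  - move/esym/eqP; rewrite mulf_eq0 => /orP[|/eqP //].
    by case: (_`!) (fact_gt0 (N - size la)) => // k _; rewrite (negPf (natr_mpoly_neq0 k)).
  - by rewrite neq_ltn ab.
  - by rewrite /= !identify_varsX eqxx if_same.
exists p => K psi inj; apply: (mulfI (vdm_neq0 inj)).
rewrite -rmorph_vdm -rmorphM -pE rmorph_sum /= mulr_sumr.
apply: eq_bigr => f fi; by rewrite (G_eval lN) // rmorph_vdm repP.
Qed.
End Existence.

(* Specializing the last two variables to z, -z recovers the same function in *)
(* N variables: this is why the limit runs over N of fixed parity.           *)
Section Cancellation.
Variables (K : fieldType) (t : nat -> K) (la : seq nat) (N : nat).
Let wid (k : 'I_N) : 'I_N.+2 := widen_ord (leqW (leqnSn N)) k.
Variables (x : 'I_N.+2 -> K) (z : K).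
Hypothesis x_inj : injective x.
Hypothesis x_last : x ord_max = - z.
Hypothesis x_prev : x (widen_ord (leqnSn N.+1) ord_max) = z.

Lemma inj_term_hit (a b : 'I_N.+2) (f : {ffun 'I_(size la) -> 'I_N.+2}) i :
  injective f -> a != b -> x a + x b = 0 -> f i = a -> inj_term t x f = 0.
Proof.
move=> fi ab xab fia; rewrite /inj_term.
suff -> : \prod_(i < size la)
      \prod_(k < N.+2 | [forall i' : 'I_(size la), (i' <= i)%N ==> (f i' != k)])
         ((x (f i) + x k) / (x (f i) - x k)) = 0 by rewrite mulr0.
apply/eqP/prodf_eq0.
case: (boolP [forall i' : 'I_(size la), (i' <= i)%N ==> (f i' != b)]) => [H|].
  exists i => //; apply/prodf_eq0; exists b => //.
  by rewrite fia xab mul0r.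
move=> /forallPn [i']; rewrite negb_imply negbK => /andP[i'i /eqP fb].
exists i' => //; apply/prodf_eq0; exists a.
  apply/forallP => i2; apply/implyP => i2i'; apply: contraNneq ab.
  rewrite -fia -fb => /fi ei; have /eqP -> // : i == i'.
  by rewrite -val_eqE eqn_leq i'i andbT -ei.
by rewrite fb addrC xab mul0r.
Qed.

Lemma inj_sum_cancel : inj_sum t la x = inj_sum t la (x \o wid).
Proof.
pose a : 'I_N.+2 := widen_ord (leqnSn N.+1) ord_max.
have xa : x a = z by [].
have ab : a != ord_max by rewrite -val_eqE /= neq_ltn leqnn.
have xab : x a + x ord_max = 0 by rewrite xa x_last subrr.
pose h (f : {ffun 'I_(size la) -> 'I_N}) : {ffun 'I_(size la) -> 'I_N.+2} :=
  [ffun i => wid (f i)].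
have wid_inj : injective wid by move=> i j /(congr1 val) /= e; apply: val_inj.
have h_inj : injective h.
  move=> f g /ffunP e; apply/ffunP => i; apply: wid_inj.
  by have := e i; rewrite !ffunE.
rewrite /inj_sum.
rewrite (bigID (fun f : {ffun 'I_(size la) -> 'I_N.+2} => [forall i, (f i < N)%N])) /=.
rewrite [X in _ + X]big1 ?addr0; last first.
  move=> f /andP[/injectiveP fi /forallPn [i]]; rewrite -leqNgt => Nf.
  have [fia|fia] := eqVneq (f i) a; first exact: (@inj_term_hit a ord_max f i).
  apply: (@inj_term_hit ord_max a f i) => //; rewrite 1?eq_sym 1?addrC //.
  apply/val_inj/eqP; rewrite /= eqn_leq -ltnS ltn_ord /=.
  by rewrite ltn_neqAle Nf andbT eq_sym.
pose injs := [set f : {ffun 'I_(size la) -> 'I_N} | injectiveb f].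
transitivity (\sum_(f in h @: injs) inj_term t x f).
  apply: eq_bigl => f; apply/andP/imsetP => [[/injectiveP fi /forallP lt]|[g]].
    exists [ffun i => Ordinal (lt i)]; last first.
      by apply/ffunP => i; rewrite !ffunE; apply: val_inj.
    rewrite inE; apply/injectiveP => i j; rewrite !ffunE => -[] e.
    by apply: fi; apply: val_inj.
  rewrite inE => /injectiveP gi ->; split.
    by apply/injectiveP => i j; rewrite !ffunE => /wid_inj /gi.
  by apply/forallP => i; rewrite ffunE /=.
rewrite big_imset /=; last by move=> f g _ _ /h_inj.
rewrite (eq_bigl (fun f : {ffun 'I_(size la) -> 'I_N} => injectiveb f)); last first.
  by move=> f; rewrite inE.
apply: eq_bigr => f _; rewrite /inj_term; congr (_ * _).
  by apply: eq_bigr => i _; rewrite ffunE.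
apply: eq_bigr => i _.
rewrite big_mkcond !big_ord_recr /= [in RHS]big_mkcond /=.
have -> : [forall i' : 'I_(size la), (i' <= i)%N ==> (h f i' != ord_max)].
  apply/forallP => i'; apply/implyP => _; rewrite ffunE -val_eqE /=.
  by rewrite neq_ltn ltnS ltnW.
have -> : [forall i' : 'I_(size la), (i' <= i)%N ==> (h f i' != a)].
  by apply/forallP => i'; apply/implyP => _; rewrite ffunE -val_eqE /= neq_ltn ltn_ord.
rewrite x_last xa opprK ffunE.
have wa k : wid k != a by rewrite -val_eqE /= neq_ltn ltn_ord.
have wb k : wid k != ord_max by rewrite -val_eqE /= neq_ltn ltnS ltnW.
rewrite -mulrA mulrACA -invfM [X in _ / X]mulrC divff ?mulr1; last first.
  apply: mulf_neq0; last by rewrite -xa subr_eq0 (inj_eq x_inj).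
  by rewrite -[z]opprK -x_last subr_eq0 (inj_eq x_inj).
apply: eq_bigr => k _.
have -> : widen_ord (leqnSn N.+1) (widen_ord (leqnSn N) k) = wid k by apply: val_inj.
have -> : [forall i' : 'I_(size la), (i' <= i)%N ==> (h f i' != wid k)] =
          [forall i' : 'I_(size la), (i' <= i)%N ==> (f i' != k)].
  by apply: eq_forallb => i'; rewrite ffunE (inj_eq wid_inj).
by [].
Qed.
End Cancellation.

Lemma rmorph_mmap (R A B : comNzRingType) (N : nat) (f : {rmorphism R -> A})
    (h : 'I_N -> A) (phi : {rmorphism A -> B}) (p : {mpoly R[N]}) :
  phi (mmap f h p) = mmap (phi \o f) (phi \o h) p.
Proof.
rewrite /mmap rmorph_sum; apply: eq_bigr => m _; rewrite rmorphM; congr (_ * _).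
by rewrite /mmap1 rmorph_prod; apply: eq_bigr => i _; rewrite rmorphXn.
Qed.

Lemma mmap_eq (R A : comNzRingType) (N : nat) (f g : R -> A)
    (h k : 'I_N -> A) (p : {mpoly R[N]}) :
  f =1 g -> h =1 k -> mmap f h p = mmap g k p.
Proof.
move=> fg hk; apply: eq_bigr => m _; rewrite fg; congr (_ * _).
exact: mmap1_eq.
Qed.

Lemma mmap_id (R : comNzRingType) (N : nat) (p : {mpoly R[N]}) :
  mmap (@mpolyC N R) (fun i => 'X_i) p = p.
Proof.
rewrite [RHS]mpolyE; apply: eq_bigr => m _.
by rewrite mmap1_id mul_mpolyC.
Qed.

(* x_i |-> 0 for i > N *)
Definition truncate (R : comNzRingType) (M N : nat) :
    {mpoly R[M]} -> {mpoly R[N]} :=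
  mmap (@mpolyC N R)
    (fun i : 'I_M => oapp (fun j : 'I_N => 'X_j) 0 (insub (val i))).

HB.instance Definition _ (R : comNzRingType) (M N : nat) :=
  GRing.RMorphism.on (@truncate R M N).

Lemma natr_neq0 (A : idomainType) : [pchar A] =i pred0 ->
  forall k, k.+1%:R != 0 :> A.
Proof. by move=> /pcharf0P ch k; rewrite ch. Qed.

Section FactorialP.
Variables (R : idomainType) (chR : [pchar R] =i pred0).
Variables (t : nat -> R) (la : seq nat).

Lemma factP_fin_ex (N : nat) : exists p : {mpoly R[N]},
  FracField.tofrac p ==
  factP_rat (fun i => FracField.tofrac (t i)%:MP) la
            (fun i : 'I_N => FracField.tofrac 'X_i).
Proof.
have [p pE] := factP_poly_ex (natr_neq0 chR) t la N.
exists p; apply/eqP; rewrite factP_ratE => [|k].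
  by rewrite pE // => i j /= /eqP; rewrite tofrac_eq => /eqP /mpolyX_inj.
rewrite -[k.+1%:R](rmorph_nat (@FracField.tofrac _)) tofrac_eq0.
exact/natr_mpoly_neq0/natr_neq0.
Qed.

(* P_la(x_1, ..., x_N | t) as a polynomial over R. *)
Definition factP_fin (N : nat) : {mpoly R[N]} := xchoose (factP_fin_ex N).

Lemma factP_finE N : FracField.tofrac (factP_fin N) =
  factP_rat (fun i => FracField.tofrac (t i)%:MP) la
            (fun i : 'I_N => FracField.tofrac 'X_i).
Proof. exact/eqP/(xchooseP (factP_fin_ex N)). Qed.

Lemma factP_fin_eval N (K : fieldType) (psi : {rmorphism {mpoly R[N]} -> K}) :
  injective (psi \o (fun i => 'X_i)) ->
  psi (factP_fin N) = inj_sum (fun i => psi (t i)%:MP) la (psi \o (fun i => 'X_i)).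
Proof.
have [p pE] := factP_poly_ex (natr_neq0 chR) t la N.
suff -> : factP_fin N = p by apply: pE.
apply/eqP; rewrite -tofrac_eq factP_finE; apply/eqP; rewrite factP_ratE => [|k].
  by rewrite pE // => i j /= /eqP; rewrite tofrac_eq => /eqP /mpolyX_inj.
rewrite -[k.+1%:R](rmorph_nat (@FracField.tofrac _)) tofrac_eq0.
exact/natr_mpoly_neq0/natr_neq0.
Qed.

Lemma factP_fin_stable N : truncate N (factP_fin N.+2) = factP_fin N.
Proof.
pose B := {poly {mpoly R[N]}}.
pose v (i : 'I_N.+2) : B :=
  if insub (val i) is Some j then ('X_(j : 'I_N) : {mpoly R[N]})%:P
  else if (i == N :> nat) then 'X else - 'X.
pose f : {rmorphism R -> B} := (@polyC {mpoly R[N]} \o @mpolyC N R).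
pose psi : {rmorphism {mpoly R[N.+2]} -> {fraction B}} :=
  (@FracField.tofrac B \o mmap f v).
pose psi0 : {rmorphism {mpoly R[N]} -> {fraction B}} :=
  (@FracField.tofrac B \o @polyC {mpoly R[N]}).
have psiX i : psi 'X_i = FracField.tofrac (v i) by rewrite /psi /= mmapX mmap1U.
have two0 : (1 + 1 : {mpoly R[N]}) != 0 by apply: (natr_mpoly_neq0 (natr_neq0 chR) N 1).
have vE (i : 'I_N.+2) : [\/ exists2 j : 'I_N, val i = val j & v i = ('X_j)%:P,
   val i = N /\ v i = 'X | val i = N.+1 /\ v i = - 'X].
  rewrite /v; case: insubP => [j _ ji|]; first by apply: Or31; exists j.
  rewrite -leqNgt => Ni; case: eqP => iN; first by apply: Or32.
  apply: Or33; split=> //; apply/eqP; rewrite eqn_leq -ltnS ltn_ord /=.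
  by rewrite ltn_neqAle Ni andbT eq_sym; apply/eqP.
have XC (c : {mpoly R[N]}) : 'X <> c%:P.
  move/(congr1 (fun p : B => p`_1)); rewrite coefX coefC /= => /eqP.
  by rewrite oner_eq0.
have NXC (c : {mpoly R[N]}) : - 'X <> c%:P.
  by move=> e; apply: (XC (- c)); rewrite polyCN -e opprK.
have XNX : ('X : B) <> - 'X.
  move/(congr1 (fun p : B => p`_1)); rewrite coefN coefX /= => /eqP.
  by rewrite -subr_eq0 opprK (negPf two0).
have v_inj : injective v.
  move=> i j; case: (vE i) => [[i' ei ->]|[ei ->]|[ei ->]];
   case: (vE j) => [[j' ej ->]|[ej ->]|[ej ->]] e; apply: val_inj; rewrite ei ej //.
  - by move: e => /polyC_inj /mpolyX_inj ->.
  - by have := XC _ (esym e).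
  - by have := NXC _ (esym e).
  - by have := XC _ e.
  - by have := NXC _ e.
  - by have := XNX (esym e).
have psi_inj : injective (psi \o (fun i => 'X_i)).
  by move=> i j /=; rewrite !mmapX !mmap1U => /eqP; rewrite tofrac_eq => /eqP /v_inj.
have psi0_inj : injective (psi0 \o (fun i => 'X_i)).
  by move=> i j /= /eqP; rewrite tofrac_eq => /eqP /polyC_inj /mpolyX_inj.
have E : psi (factP_fin N.+2) = psi0 (factP_fin N).
  rewrite !factP_fin_eval // (@inj_sum_cancel _ _ _ _ _ (FracField.tofrac 'X)) //.
  - rewrite /inj_sum; apply: eq_bigr => g _.
    rewrite /inj_term; congr (_ * _).
      apply: eq_bigr => i _; apply: eq_bigr => j _ /=.
      by rewrite mmapX mmap1U mmapC /v /= valK.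
    apply: eq_bigr => i _; apply: eq_bigr => k _ /=.
    by rewrite !mmapX !mmap1U /v /= !valK.
  - rewrite /= mmapX mmap1U -rmorphN; congr FracField.tofrac.
    by rewrite /v insubF /= ?ltnNge ?leqnSn //; case: eqP => // /esym/n_Sn.
  - rewrite /= mmapX mmap1U; congr FracField.tofrac.
    by rewrite /v insubF /= ?ltnn // eqxx.
have {}E : mmap f v (factP_fin N.+2) = (factP_fin N)%:P.
  by apply/eqP; rewrite -tofrac_eq; apply/eqP.
have /(congr1 (horner_eval 0)) := E; rewrite rmorph_mmap /horner_eval /= hornerC => <-.
apply: mmap_eq => [c|i] /=; first by rewrite /f /= /horner_eval hornerC.
rewrite /horner_eval /v; case: insubP => [j _ _|_] /=; first by rewrite hornerC.
by case: ifP => _; rewrite ?hornerN hornerX ?oppr0.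
Qed.
End FactorialP.

(* The projective limit of the rings R[x_1, ..., x_N] over even N = 2m. If R *)
(* is free over Z, it contains R (x) Gamma', identifying an element with the  *)
(* sequence of its truncations to x_1, ..., x_N; the subalgebra generated by  *)
(* elements of R (x) Gamma', and the ideals of that subalgebra, are the same  *)
(* whether formed in R (x) Gamma' or here.                                    *)
Record plim (R : comNzRingType) := Plim {
  plim_val :> forall m : nat, {mpoly R[m.*2]};
  plimP : forall m : nat, truncate m.*2 (plim_val m.+1) = plim_val m }.

Section PlimRing.
Variable R : comNzRingType.
Implicit Types f g h : plim R.

Lemma plim_ext f g : (forall m, f m = g m) -> f = g.
Proof.
case: f g => f fP [g gP] /= e; have {}e := boolp.functional_extensionality_dep e.
by case: _ / e gP => gP; congr Plim; apply: boolp.Prop_irrelevance.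
Qed.

HB.instance Definition _ := boolp.gen_eqMixin (plim R).
HB.instance Definition _ := boolp.gen_choiceMixin (plim R).

Fact plim_zeroP m : truncate m.*2 (0 : {mpoly R[m.+1.*2]}) = 0.
Proof. exact: rmorph0. Qed.
Fact plim_oneP m : truncate m.*2 (1 : {mpoly R[m.+1.*2]}) = 1.
Proof. exact: rmorph1. Qed.
Fact plim_addP f g m : truncate m.*2 (f m.+1 + g m.+1) = f m + g m.
Proof. by rewrite rmorphD /= !plimP. Qed.
Fact plim_oppP f m : truncate m.*2 (- f m.+1) = - f m.
Proof. by rewrite rmorphN /= plimP. Qed.
Fact plim_mulP f g m : truncate m.*2 (f m.+1 * g m.+1) = f m * g m.
Proof. by rewrite rmorphM /= !plimP. Qed.
Fact plim_scaleP (c : R) f m : truncate m.*2 (c *: f m.+1) = c *: f m.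
Proof. by rewrite /truncate mmapZ mul_mpolyC -[mmap _ _ _]/(truncate _ _) plimP. Qed.

Definition plim_zero := @Plim R (fun=> 0) plim_zeroP.
Definition plim_one := @Plim R (fun=> 1) plim_oneP.
Definition plim_add f g := Plim (plim_addP f g).
Definition plim_opp f := Plim (plim_oppP f).
Definition plim_mul f g := Plim (plim_mulP f g).
Definition plim_scale (c : R) f := Plim (plim_scaleP c f).

Fact plim_addA : associative plim_add.
Proof. by move=> f g h; apply: plim_ext => m /=; rewrite addrA. Qed.
Fact plim_addC : commutative plim_add.
Proof. by move=> f g; apply: plim_ext => m /=; rewrite addrC. Qed.
Fact plim_add0 : left_id plim_zero plim_add.
Proof. by move=> f; apply: plim_ext => m /=; rewrite add0r. Qed.
Fact plim_addN : left_inverse plim_zero plim_opp plim_add.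
Proof. by move=> f; apply: plim_ext => m /=; rewrite addNr. Qed.

HB.instance Definition _ :=
  GRing.isZmodule.Build (plim R) plim_addA plim_addC plim_add0 plim_addN.

Fact plim_mulA : associative plim_mul.
Proof. by move=> f g h; apply: plim_ext => m /=; rewrite mulrA. Qed.
Fact plim_mulC : commutative plim_mul.
Proof. by move=> f g; apply: plim_ext => m /=; rewrite mulrC. Qed.
Fact plim_mul1 : left_id plim_one plim_mul.
Proof. by move=> f; apply: plim_ext => m /=; rewrite mul1r. Qed.
Fact plim_mulD : left_distributive plim_mul plim_add.
Proof. by move=> f g h; apply: plim_ext => m /=; rewrite mulrDl. Qed.
Fact plim_one_neq0 : plim_one != 0.
Proof.
by apply/eqP => /(congr1 (fun f : plim R => f 0%N)) /= /eqP; rewrite oner_eq0.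
Qed.

HB.instance Definition _ := GRing.Zmodule_isComNzRing.Build (plim R)
  plim_mulA plim_mulC plim_mul1 plim_mulD plim_one_neq0.

Fact plim_scaleA (a b : R) f :
  plim_scale a (plim_scale b f) = plim_scale (a * b) f.
Proof. by apply: plim_ext => m /=; rewrite scalerA. Qed.
Fact plim_scale1 : left_id 1 plim_scale.
Proof. by move=> f; apply: plim_ext => m /=; rewrite scale1r. Qed.
Fact plim_scaleDr : right_distributive plim_scale +%R.
Proof. by move=> c f g; apply: plim_ext => m /=; rewrite scalerDr. Qed.
Fact plim_scaleDl f : {morph plim_scale^~ f : a b / a + b}.
Proof. by move=> a b; apply: plim_ext => m /=; rewrite scalerDl. Qed.

HB.instance Definition _ := GRing.Zmodule_isLmodule.Build R (plim R)
  plim_scaleA plim_scale1 plim_scaleDr plim_scaleDl.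

Fact plim_scaleAl (c : R) f g : c *: (f * g) = (c *: f) * g.
Proof. by apply: plim_ext => m /=; rewrite scalerAl. Qed.

HB.instance Definition _ := GRing.Lmodule_isLalgebra.Build R (plim R) plim_scaleAl.
HB.instance Definition _ := GRing.Lalgebra_isComAlgebra.Build R (plim R).
End PlimRing.

(* P_la(x|t) *)
Definition factP (R : idomainType) (chR : [pchar R] =i pred0) (t : nat -> R)
    (la : seq nat) : plim R :=
  Plim (fun m => factP_fin_stable chR t la m.*2).

Definition strict_part (la : seq nat) : bool := sorted gtn la && (0%N \notin la).

Definition SP (n : nat) (la : seq nat) : bool :=
  strict_part la && (nth 0%N la 0 <= n)%N.

(* All ways of adding one box to la (incr_nth la (size la) appends a part 1), *)
(* whether or not the result is a strict partition.                           *)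
Definition add_box (la : seq nat) : seq (seq nat) :=
  [seq incr_nth la i | i <- iota 0 (size la).+1].

(* S[q] *)
Notation Sq n := {poly {mpoly int[n.+1]}}.

Lemma pchar_Sq (n : nat) : [pchar (Sq n)] =i pred0.
Proof.
apply/pcharf0P => -[|k]; first by rewrite mulr0n !eqxx.
rewrite -[k.+1%:R](rmorph_nat (@polyC {mpoly int[n.+1]})) polyC_eq0.
by rewrite -[k.+1%:R](rmorph_nat (@mpolyC n.+1 int)) mpolyC_eq0 Num.Theory.pnatr_eq0.
Qed.

Definition qvar (n : nat) : Sq n := 'X.

(* t_{i+1}, specialized to 0 when i + 1 > n + 1. *)
Definition tvar (n i : nat) : Sq n :=
  if (i <= n)%N then ('X_(inord i : 'I_n.+1))%:P else 0.

(* P_la(x|t) in S[q] (x) Gamma', with t_i = 0 for i > n + 1. *)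
Definition Pt (n : nat) (la : seq nat) : plim (Sq n) :=
  factP (@pchar_Sq n) (tvar n) la.

(* Membership in S[q][P_1(x|t), ..., P_{2n}(x|t)]. *)
Definition in_subalg (n : nat) (x : plim (Sq n)) : Prop :=
  exists p : {mpoly (Sq n)[n.*2]},
    x = mmap (in_alg (plim (Sq n))) (fun i : 'I_n.*2 => Pt n [:: i.+1]) p.

(* P_{n+1}, ..., P_{2n-1}, P_{2n} + (-1)^n q *)
Definition ideal_gen (n : nat) (i : 'I_n) : plim (Sq n) :=
  Pt n [:: (n + i.+1)%N]
  + (if i.+1 == n then ((-1) ^+ n * qvar n)%:A else 0).

Definition in_ideal (n : nat) (x : plim (Sq n)) : Prop :=
  exists a : 'I_n -> plim (Sq n),
    (forall i, in_subalg (a i)) /\ x = \sum_(i < n) a i * ideal_gen i.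

Definition eqmod_ideal (n : nat) (x y : plim (Sq n)) : Prop := in_ideal (x - y).

(* Main.v *)
Require Import Defs.
From mathcomp Require Import all_boot all_order all_fingroup all_algebra.
From mathcomp Require Import mpoly.
From mathcomp Require Import ring zify.
Set Implicit Arguments.
Unset Strict Implicit.
Unset Printing Implicit Defensive.
Import GRing.Theory.
Local Open Scope ring_scope.

(** Choosing the variables of [P_la] one at a time gives a recursion over
    subsets [A] of the variables (recP).  Interpolating the polynomial
    [prod (z + x_k) - prod (z - x_k)] at the points [x_k] evaluates the sums it
    involves; since [P_1] is the sum of the variables, the equivariant Pieri rule
    follows by splitting off the chosen variables one by one.

    Rewriting the recursion as a sum over all tuples, with weight the product of
    [(y_j - y_i) / (y_j + y_i)] over [i < j], Schur's Pfaffian identity expands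
    [P_la] along its first row in terms of the [P_(k,l)].  Dividing [(y_2|t)^l]
    by [y_2 + y_1] expresses [P_(k,l)] through products [P_i P_j] with [i >= k]
    and through [P_k, ..., P_(k+l)].  This bounds the generators needed, and shows
    that modulo the ideal [P_(n+1,m)] is [q] if [m = n - 1] and [0] if
    [m < n - 1].  The only term of the Pieri rule outside [SP n] is
    [P_(n+1, la_2, ...)], whose first row expansion thus yields the [q]-term. *)

(** * Lagrange interpolation at a subset of the variables *)

Lemma prod_XsubC_enum (R : comNzRingType) (I : finType) (A : {set I}) (y : I -> R) :
  \prod_(k in A) ('X - (y k)%:P) = \prod_(c <- [seq y k | k <- enum A]) ('X - c%:P).
Proof. by rewrite big_map big_enum. Qed.

(** The difference of the two sides has size at most [#|A|] and vanishes at the [#|A|] distinct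
    points [x i]. *)
Lemma lagrange_interpolation (K : fieldType) (I : finType) (x : I -> K)
    (A : {set I}) (p : {poly K}) :
  injective x -> (size p <= #|A|)%N ->
  p = \sum_(i in A) (p.[x i] / \prod_(j in A :\ i) (x i - x j))
        *: \prod_(j in A :\ i) ('X - (x j)%:P).
Proof.
move=> x_inj sp; apply/eqP; rewrite -subr_eq0; apply/eqP.
apply: (@roots_geq_poly_eq0 _ _ [seq x i | i <- enum A]).
- apply/allP => y /mapP[i]; rewrite mem_enum => iA -> {y}.
  rewrite rootE hornerD hornerN horner_sum (bigD1 i) //= [X in _ - (_ + X)]big1.
    rewrite addr0 hornerZ horner_prod.
    under [X in _ / _ * X]eq_bigr do rewrite !hornerE.
    rewrite divfK ?subrr //; apply/prodf_neq0 => j; rewrite !inE => /andP[ji _].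
    by rewrite subr_eq0 (inj_eq x_inj) eq_sym.
  move=> j /andP[jA ji]; rewrite hornerZ horner_prod [X in _ * X](bigD1 i) ?inE 1?eq_sym ?ji //=.
  by rewrite hornerXsubC subrr mul0r mulr0.
- by rewrite map_inj_uniq // enum_uniq.
- rewrite size_map -cardE (leq_trans (size_polyD _ _)) // geq_max sp size_polyN.
  apply: (leq_trans (size_sum _ _ _)); apply/bigmax_leqP => i iA.
  apply: (leq_trans (size_scale_leq _ _)).
  by rewrite prod_XsubC_enum size_prod_XsubC size_map -cardE (cardsD1 i A) iA.
Qed.

(** * Sums of cross factors obtained by interpolation *)

Section RationalIdentities.
Variables (K : fieldType) (I : finType) (x : I -> K).
Hypothesis x_inj : injective x.
Hypothesis x_add : forall i j, x i + x j != 0.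

(** The factor that [k] contributes to the factorial function when it is picked from the remaining
    variables [A]. *)
Definition cross (A : {set I}) (k : I) : K :=
  \prod_(j in A :\ k) ((x k + x j) / (x k - x j)).

Let gap (A : {set I}) : {poly K} :=
  \prod_(k in A) ('X + (x k)%:P) - \prod_(k in A) ('X - (x k)%:P).

Let gapE (A : {set I}) : gap A =
  \prod_(c <- [seq - x k | k <- enum A]) ('X - c%:P)
  - \prod_(c <- [seq x k | k <- enum A]) ('X - c%:P).
Proof.
rewrite -!prod_XsubC_enum; congr (_ - _); apply: eq_bigr => k _.
by rewrite polyCN opprK.
Qed.

(** Both products are monic of degree [#|A|], so the leading terms cancel. *)
Let size_gap (A : {set I}) : (size (gap A) <= #|A|)%N.
Proof.
apply/leq_sizeP => j; rewrite leq_eqVlt => /orP[/eqP <-|Aj]; last first.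
  by rewrite gapE coefB !nth_default ?subrr // size_prod_XsubC size_map -cardE.
have lc (s : seq K) : size s = #|A| -> (\prod_(c <- s) ('X - c%:P))`_#|A| = 1.
  move=> sA; have /eqP := monic_prod_XsubC s predT id.
  by rewrite lead_coefE size_prod_XsubC sA.
by rewrite gapE coefB !lc ?subrr // size_map -cardE.
Qed.

Let gap_sample (A : {set I}) i : i \in A ->
  (gap A).[x i] / \prod_(j in A :\ i) (x i - x j) = (x i + x i) * cross A i.
Proof.
move=> iA; rewrite hornerD hornerN !horner_prod (bigD1 i) //= [X in _ - X](bigD1 i) //=.
rewrite !hornerE subrr mul0r subr0 -mulrA; congr (_ * _).
rewrite /cross big_split /= prodfV; congr (_ / _).
by apply: eq_big => [j|j _]; rewrite ?inE ?hornerE // andbC.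
Qed.

Lemma gap_lagrange (A : {set I}) : gap A =
  \sum_(i in A) ((x i + x i) * cross A i) *: \prod_(j in A :\ i) ('X - (x j)%:P).
Proof.
rewrite [LHS](lagrange_interpolation x_inj (size_gap A)).
by apply: eq_bigr => i iA; rewrite gap_sample.
Qed.

Lemma x_neq0 i : x i != 0.
Proof. by apply: contraNneq (x_add i i) => ->; rewrite addr0. Qed.

Lemma two_neq0 (i : I) : 2%:R != 0 :> K.
Proof.
by apply: contraNneq (x_add i i) => t0; rewrite -mulr2n -mulr_natl t0 mul0r.
Qed.

(** Evaluation of [gap_lagrange] at 0: up to a common sign, each summand is [2 * cross A i] times
    the product of all variables in [A]. *)
Lemma sum_cross (A : {set I}) : \sum_(k in A) cross A k = (odd #|A|)%:R.
Proof.
have [->|[i0 i0A]] := set_0Vmem A; first by rewrite big_set0 cards0.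
have X0 : \prod_(k in A) x k != 0 by apply/prodf_neq0 => k _; apply: x_neq0.
have /(congr1 (fun p => p.[0])) := gap_lagrange A.
rewrite horner_sum hornerD hornerN !horner_prod.
under eq_bigr do rewrite hornerD hornerX hornerC add0r.
under [X in _ - X]eq_bigr do rewrite hornerXsubC sub0r.
rewrite prodrN -signr_odd => e.
apply: (mulfI X0); apply: (mulfI (two_neq0 i0));
have {e} : 2%:R * (\prod_(k in A) x k * \sum_(k in A) cross A k) =
     - (-1) ^+ odd #|A| * (\prod_(i in A) x i - (-1) ^+ odd #|A| * \prod_(i in A) x i).
  rewrite e !mulr_sumr; apply: eq_bigr => i iA.
  have eP : (\prod_(j in A :\ i) ('X - (x j)%:P)).[0]
      = (-1) ^+ #|A :\ i| * \prod_(j in A :\ i) x j.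
    by rewrite horner_prod -prodrN; apply: eq_bigr => j _; rewrite hornerXsubC sub0r.
  rewrite hornerZ eP [X in 2%:R * (X * _)](big_setD1 i) //=.
  rewrite (cardsD1 i A) iA /= -[in RHS](signr_odd _ #|A :\ i|).
  by case: (odd _) => /=; rewrite ?expr0 ?expr1; ring.
by move=> ->; case: (odd _) => /=; rewrite ?expr0 ?expr1; ring.
Qed.

(** Comparison of coefficients of degree [#|A| - 1] in [gap_lagrange]: there [gap] has twice the sum
    of the variables, and the Lagrange products are monic of that degree. *)
Lemma sum_mul_cross (A : {set I}) : \sum_(k in A) x k * cross A k = \sum_(k in A) x k.
Proof.
have [->|[i0 i0A]] := set_0Vmem A; first by rewrite !big_set0.
have cA : size (enum A) != 0%N by rewrite -cardE cards_eq0; apply/set0Pn; exists i0.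
have /(congr1 (fun p : {poly K} => p`_(#|A|.-1))) := gap_lagrange A.
rewrite coef_sum gapE coefB.
have sN : #|A| = size [seq - x k | k <- enum A] by rewrite size_map -cardE.
have sP : #|A| = size [seq x k | k <- enum A] by rewrite size_map -cardE.
rewrite {1}sN {1}sP !coefPn_prod_XsubC ?size_map //.
rewrite !big_map !big_enum /= sumrN !opprK => e.
apply: (mulfI (two_neq0 i0)); rewrite -[2%:R]/(1 + 1) !mulrDl !mul1r e -big_split /=.
apply: eq_bigr => i iA; rewrite coefZ -mulrDl -[LHS]mulr1; congr (_ * _).
rewrite prod_XsubC_enum.
have /eqP := monic_prod_XsubC [seq x k | k <- enum (A :\ i)] predT id.
by rewrite lead_coefE size_prod_XsubC size_map -cardE (cardsD1 i A) iA.
Qed.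

Definition skew (a b : I) : K := (x b - x a) / (x b + x a).

(** Evaluation of [gap_lagrange] at [- x a], divided by the product of the [x k + x a]. Since
    [2 x_k / (x_k + x_a) = skew a k + 1], the surplus is the sum of [cross], which is 1 and matches
    the second product of [gap]. *)
Lemma prod_skew_cross (A : {set I}) a : odd #|A| ->
  \prod_(k in A) skew a k = \sum_(k in A) cross A k * skew a k.
Proof.
move=> oA; have /(congr1 (fun p => p.[- x a])) := gap_lagrange A.
have D0 : \prod_(k in A) (x k + x a) != 0 by apply/prodf_neq0 => k _; apply: x_add.
rewrite horner_sum hornerD hornerN !horner_prod.
under eq_bigr do rewrite hornerD hornerX hornerC addrC.
have -> : \prod_(i in A) ('X - (x i)%:P).[- x a] = - \prod_(k in A) (x k + x a).
  under eq_bigr do rewrite hornerXsubC -opprD addrC.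
  by rewrite prodrN -signr_odd oA expr1 mulN1r.
rewrite opprK => /(congr1 (fun c => c / \prod_(k in A) (x k + x a))).
rewrite mulrDl divff // -prodfV -big_split /= => e.
apply: (addIr 1); rewrite e mulr_suml.
have E1 : \sum_(k in A) cross A k = 1 by rewrite sum_cross oA.
rewrite -[X in _ = _ + X]E1 -big_split /=; apply: eq_bigr => i iA; rewrite hornerZ horner_prod.
have -> : \prod_(j in A :\ i) ('X - (x j)%:P).[- x a] = \prod_(j in A :\ i) (x j + x a).
  under eq_bigr do rewrite hornerXsubC -opprD addrC.
  rewrite prodrN -signr_odd; move: oA; rewrite (cardsD1 i A) iA /= => /negPf ->.
  by rewrite expr0 mul1r.
rewrite prodfV [X in _ / X](big_setD1 i) //=.
rewrite invfM mulrACA divff; last by apply/prodf_neq0 => k _; apply: x_add.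
rewrite /skew; field; exact: x_add.
Qed.
End RationalIdentities.

(** * Removing one entry of a sequence *)

Lemma unbump_ltn m i j : i != m -> j != m -> (i < j)%N -> (unbump m i < unbump m j)%N.
Proof. by rewrite /unbump => /eqP mi /eqP mj ij; lia. Qed.

Lemma unbump_ltn_pred m j n : j != m -> (m < n)%N -> (j < n)%N -> (unbump m j < n.-1)%N.
Proof. by rewrite /unbump => /eqP mj mn jn; lia. Qed.

Definition dropat (T : Type) j (s : seq T) := take j s ++ drop j.+1 s.

Lemma dropat_nth (T : Type) (a : T) j (s : seq T) : (j < size s)%N ->
  s = take j s ++ nth a s j :: drop j.+1 s.
Proof. by move=> js; rewrite -drop_nth // cat_take_drop. Qed.

Lemma nth_dropat (T : Type) (a : T) j k (s : seq T) : (j < size s)%N ->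
  nth a (dropat j s) k = nth a s (bump j k).
Proof.
move=> js; rewrite /dropat nth_cat size_take js /bump; case: ltnP => kj.
  by rewrite nth_take.
by rewrite nth_drop; congr nth; lia.
Qed.

Lemma size_dropat (T : Type) j (s : seq T) :
  (j < size s)%N -> size (dropat j s) = (size s).-1.
Proof. by move=> js; rewrite size_cat size_take js size_drop; lia. Qed.

Lemma all_dropat (T : Type) (p : pred T) j (s : seq T) : all p s -> all p (dropat j s).
Proof.
rewrite -{1}(cat_take_drop j s) /dropat !all_cat => /andP[-> /= h].
by move: h; rewrite -addn1 addnC -drop_drop; case: (drop j s) => [|a s'] //= /andP[_]; rewrite drop0.
Qed.

(** * The recursion over sets of variables *)

Section SetRecursion.
Variables (K : fieldType) (I : finType) (x : I -> K).
Hypothesis x_inj : injective x.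
Hypothesis x_add : forall i j, x i + x j != 0.
Variable h : nat -> I -> K.

Implicit Types (la : seq nat) (A : {set I}).

(** Here [h l k] stands for the factorial power [(x_k|t)^l]. Each step picks the variable of the
    first part and pairs it with the variables not yet picked. *)
Fixpoint recP (la : seq nat) (A : {set I}) : K :=
  if la is l :: la' then \sum_(k in A) h l k * cross x A k * recP la' (A :\ k)
  else 1.

Lemma recP_rcons0 la A : h 0 =1 (fun=> 1) -> odd (#|A| + size la) ->
  recP (rcons la 0%N) A = recP la A.
Proof.
move=> h0; elim: la A => [|l la IH] A /=.
  rewrite addn0 => oA; transitivity (\sum_(k in A) cross x A k).
    by apply: eq_bigr => k _; rewrite h0 mul1r mulr1.
  by rewrite sum_cross // oA.
move=> oA; apply: eq_bigr => k kA; rewrite IH //.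
by move: oA; rewrite (cardsD1 k A) kA; lia.
Qed.

(** Exchanging the variables picked for the two equal parts negates the summand, so the sum is its
    own opposite. *)
Lemma recP_dup s1 a s2 A : recP (s1 ++ a :: a :: s2) A = 0.
Proof.
elim: s1 A => [|l la IH] A /=; last first.
  by rewrite big1 // => k _; rewrite IH mulr0.
pose F k k' := h a k * cross x A k * (h a k' * cross x (A :\ k) k' * recP s2 (A :\ k :\ k')).
have FE k k' : k \in A -> k' \in A -> k != k' -> F k k' = - F k' k.
  move=> kA k'A kk'.
  have Bk : k' \in A :\ k by rewrite !inE eq_sym kk'.
  have Bk' : k \in A :\ k' by rewrite !inE kk'.
  have BE : A :\ k' :\ k = A :\ k :\ k' by apply/setP => j; rewrite !inE andbCA.
  rewrite /F BE /cross (big_setD1 k') //= [in RHS](big_setD1 k) //= BE.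
  have n0 : x k - x k' != 0 by rewrite subr_eq0 (inj_eq x_inj).
  have n0' : x k' - x k != 0 by rewrite subr_eq0 (inj_eq x_inj) eq_sym.
  by field; rewrite n0 n0'.
have S : \sum_(k in A) \sum_(k' in A :\ k) F k k' = - \sum_(k in A) \sum_(k' in A :\ k) F k k'.
  rewrite {1}(exchange_big_dep (fun k => k \in A)) /=; last first.
    by move=> k k' _; rewrite !inE => /andP[].
  rewrite -sumrN; apply: eq_bigr => k kA; rewrite -sumrN.
  apply: eq_big => [k'|k' /andP[k'A]]; first by rewrite !inE kA andbT eq_sym andbC.
  by rewrite !inE => /andP[kk' _]; rewrite FE // eq_sym.
under eq_bigr do rewrite mulr_sumr.
have [A0|[i0 i0A]] := set_0Vmem A; first by rewrite A0 big_set0.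
move/eqP: S; rewrite -addr_eq0 -mulr2n -mulr_natl mulf_eq0.
by rewrite (negPf (two_neq0 x_add i0)) => /eqP.
Qed.

(** * Sums over tuples and the Pfaffian expansion *)

Fixpoint skewD (s : seq I) : K :=
  if s is a :: s' then (\prod_(b <- s') skew x a b) * skewD s' else 1.

(** The tuples range freely, repetitions included, and [cross] is always taken over all variables,
    so the entries are coupled only through [G]. *)
Fixpoint msum (la : seq nat) (G : seq I -> K) : K :=
  if la is l :: la' then
    \sum_k h l k * cross x setT k * msum la' (fun s => G (k :: s))
  else G [::].

Lemma eq_msum la G1 G2 : (forall s, size s = size la -> G1 s = G2 s) ->
  msum la G1 = msum la G2.
Proof.
elim: la G1 G2 => [|l la IH] G1 G2 e /=; first exact: e.
by apply: eq_bigr => k _; congr (_ * _); apply: IH => s sE; apply: e; rewrite /= sE.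
Qed.

Lemma mulr_msum la c G : msum la (fun s => c * G s) = c * msum la G.
Proof.
elim: la G => [|l la IH] G //=; rewrite mulr_sumr.
by apply: eq_bigr => k _; rewrite (IH (fun s => G (k :: s))) mulrCA.
Qed.

Lemma msum_sum la (J : finType) (G : J -> seq I -> K) :
  msum la (fun s => \sum_j G j s) = \sum_j msum la (G j).
Proof.
elim: la G => [|l la IH] G //=; rewrite exchange_big; apply: eq_bigr => k _.
by rewrite (IH (fun j s => G j (k :: s))) mulr_sumr.
Qed.

Lemma cross_setT (A : {set I}) k : k \in A ->
  cross x A k = cross x setT k * \prod_(j in ~: A) skew x j k.
Proof.
move=> kA; rewrite /cross [X in _ = X * _](big_setID A) /=.
have -> : (setT :\ k) :&: A = A :\ k by apply/setP => j; rewrite !inE andbT.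
have -> : (setT :\ k) :\: A = ~: A.
  by apply/setP => j; rewrite !inE andbT; case: eqP => [->|_]; rewrite ?kA ?andbT.
rewrite -mulrA -[LHS]mulr1 -big_split /=; congr (_ * _).
rewrite big1 // => j; rewrite inE => jA.
have kj : x k - x j != 0.
  by rewrite subr_eq0 (inj_eq x_inj); apply: contraNneq jA => <-.
by rewrite /skew; field; rewrite kj x_add.
Qed.

(** The complement of [A] holds the variables picked so far; their [skew] factors reduce [cross]
    over all variables to [cross] over [A], by [cross_setT]. *)
Lemma recP_msum la A : recP la A =
  msum la (fun s => (\prod_(k <- s) \prod_(j in ~: A) skew x j k) * skewD s).
Proof.
elim: la A => [|l la IH] A /=; first by rewrite big_nil mul1r.
(* A variable picked before contributes nothing, because [skew x k k] is 0. *)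
rewrite [RHS](bigID (fun k => k \in A)) /= [X in _ + X]big1 ?addr0; last first.
  move=> k kA; rewrite (@eq_msum _ _ (fun s => 0 * 0)); first by rewrite mulr_msum mul0r mulr0.
  move=> s _; rewrite big_cons (bigD1 k) ?inE //= /skew subrr mul0r !mul0r.
  by [].
apply: eq_bigr => k kA; rewrite cross_setT // IH -!mulrA; congr (_ * (_ * _)).
rewrite -mulr_msum; apply: eq_msum => s _ /=; rewrite big_cons -mulrA; congr (_ * _).
rewrite mulrA -big_split /=; congr (_ * _); apply: eq_bigr => b _.
have -> : ~: (A :\ k) = k |: ~: A.
  by apply/setP => j; rewrite !inE negb_and negbK.
by rewrite big_setU1 ?inE ?kA //= mulrC.
Qed.

Corollary recP_setT la : recP la setT = msum la skewD.
Proof.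
rewrite recP_msum; apply: eq_msum => s _.
by rewrite big1 ?mul1r // => k _; rewrite setCT big_set0.
Qed.

Lemma msum_dropat a la j (phi : I -> K) G : (j < size la)%N ->
  msum la (fun s => phi (nth a s j) * G (dropat j s)) =
  (\sum_k h (nth 0%N la j) k * cross x setT k * phi k) * msum (dropat j la) G.
Proof.
elim: j la G => [|j IH] [|l la] G //= jla.
  rewrite /dropat /= drop0 mulr_suml; apply: eq_bigr => k _.
  by rewrite -[RHS]mulrA; congr (_ * _); rewrite -mulr_msum; apply: eq_msum => s _; rewrite drop0.
rewrite /dropat /= -/(dropat j la) mulr_sumr; apply: eq_bigr => k _.
by rewrite mulrCA -(IH la (fun s => G (k :: s))).
Qed.

Lemma skewC a b : skew x a b = - skew x b a.
Proof. by rewrite /skew -mulNr opprB [x a + _]addrC. Qed.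

Lemma prod_skewC s c :
  \prod_(k <- s) skew x k c = (-1) ^+ size s * \prod_(k <- s) skew x c k.
Proof.
elim: s => [|k s IH]; first by rewrite !big_nil mulr1.
by rewrite !big_cons IH skewC /= exprS; ring.
Qed.

Lemma skewD_insert s1 c s2 : skewD (s1 ++ c :: s2) =
  \prod_(k <- s1) skew x k c * \prod_(k <- s2) skew x c k * skewD (s1 ++ s2).
Proof.
elim: s1 => [|a s1 IH] /=; first by rewrite big_nil mul1r.
by rewrite IH !big_cat !big_cons /=; ring.
Qed.

Lemma skewD_dup s : ~~ uniq s -> skewD s = 0.
Proof.
elim: s => [|a s IH] //=; rewrite negb_and negbK => /orP[a_s|/IH ->].
  by rewrite (big_rem a) //= {1}/skew subrr !mul0r.
by rewrite mulr0.
Qed.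

(** The factors of [a] are expanded by [prod_skew_cross] over the set of entries of [b]; up to sign,
    [cross] at an entry [c] then cancels all factors of [c] in [skewD b]. *)
Lemma skewD_expand_uniq a b : uniq b -> odd (size b) ->
  skewD (a :: b) =
  \sum_(j < size b) (-1) ^+ j * (skew x a (nth a b j) * skewD (dropat j b)).
Proof.
move=> ub ob /=; rewrite (big_uniq _ ub) /=.
have -> : \prod_(i in b) skew x a i = \prod_(i in [set k in b]) skew x a i.
  by apply: eq_bigl => i; rewrite inE.
rewrite prod_skew_cross //; last by rewrite cardsE (card_uniqP ub).
rewrite (eq_bigl (fun i => i \in b)) => [|i]; last by rewrite inE.
rewrite -(big_uniq _ ub) /= (big_nth a) big_mkord mulr_suml; apply: eq_bigr => j _.
have jb := ltn_ord j; set c := nth a b j.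
have bE : b = take j b ++ c :: drop j.+1 b by apply: dropat_nth.
have uc : uniq (dropat j b) /\ c \notin dropat j b.
  have : perm_eq b (c :: dropat j b).
    by rewrite {1}bE /dropat perm_catC /= perm_cons perm_catC.
  by move/perm_uniq; rewrite ub /= => /esym/andP[].
have -> : cross x [set k in b] c = \prod_(k <- dropat j b) ((x c + x k) / (x c - x k)).
  rewrite (big_uniq _ uc.1) /=; apply: eq_bigl => k; rewrite !inE {1}bE mem_cat inE.
  rewrite /dropat mem_cat; case: eqP => [->|_] //=.
  by rewrite -mem_cat; apply/esym/negbTE/uc.2.
have D0 k : k \in dropat j b -> x c - x k != 0.
  move=> kb; rewrite subr_eq0 (inj_eq x_inj); apply: contraNneq uc.2 => ->//.
have -> : skewD b = \prod_(k <- take j b) skew x k c *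
    \prod_(k <- drop j.+1 b) skew x c k * skewD (dropat j b).
  by rewrite {1}bE skewD_insert.
suff <- : \prod_(k <- dropat j b) ((x c + x k) / (x c - x k)) *
    (\prod_(k <- take j b) skew x k c * \prod_(k <- drop j.+1 b) skew x c k) = (-1) ^+ j.
  by ring.
rewrite /dropat big_cat /= mulrACA -!big_split /=.
rewrite (@big_seq _ _ _ _ (take j b)) big1 ?mul1r; last first.
  move=> k kb; have := D0 k; rewrite mem_cat kb => /(_ isT) d.
  by rewrite /skew; field; rewrite d x_add.
rewrite (@big_seq _ _ _ _ (drop j.+1 b)) (eq_bigr (fun=> -1)); last first.
  move=> k kb; have := D0 k; rewrite mem_cat kb orbT => /(_ isT) d.
  have d' : x k + x c != 0 by exact: x_add.
  by rewrite /skew; field; rewrite d d'.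
(* Entries before [c] give 1 and entries after it give -1; as [size b] is odd, the number of the
   latter has the parity of [j]. *)
rewrite -big_seq big_const_seq count_predT iter_mulr_1 size_drop -signr_odd -[RHS]signr_odd.
by rewrite oddB // ob /= negbK.
Qed.

(* Schur's Pfaffian identity.  Repeated entries in [b] have to be allowed: a   *)
(* product of two sums over tuples contains the terms where the tuples meet.   *)
Lemma skewD_expand a b : odd (size b) ->
  skewD (a :: b) =
  \sum_(j < size b) (-1) ^+ j * (skew x a (nth a b j) * skewD (dropat j b)).
Proof.
move=> ob; have [ub|nub] := boolP (uniq b); first exact: skewD_expand_uniq.
rewrite skewD_dup /= ?negb_and ?nub ?orbT //.
have /(uniqPn a)[i [j [ij jb eij]]] := nub.
have ib : (i < size b)%N by apply: ltn_trans jb.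
(* The left side is 0. On the right, only removing position [i] or [j] can destroy the repetition,
   and these two terms cancel. *)
rewrite (bigD1 (Ordinal ib)) //= (bigD1 (Ordinal jb)) /=; last first.
  by rewrite -val_eqE /= neq_ltn ij orbT.
rewrite [X in _ + (_ + X)]big1 ?addr0; last first.
  move=> m /andP[]; rewrite -!val_eqE /= => mi mj.
  rewrite skewD_dup ?mulr0 //; apply/(uniqPn a); exists (unbump m i), (unbump m j).
  have jm := ltn_ord m.
  rewrite eq_sym in mi; rewrite eq_sym in mj.
  rewrite size_dropat // !nth_dropat // !unbumpKcond (negPf mi) (negPf mj).
  by split; rewrite ?unbump_ltn ?unbump_ltn_pred ?add0n.
rewrite -eij.
(* The two tuples differ by moving the repeated entry past the [j - i - 1] entries in between, each
   of which changes the sign. *)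
suff -> : skewD (dropat i b) = (-1) ^+ (j - i.+1) * skewD (dropat j b).
  have -> : (-1) ^+ j = - ((-1) ^+ i * (-1) ^+ (j - i.+1)) :> K.
    by rewrite -exprD -[RHS]mulN1r -exprS; congr (_ ^+ _); lia.
  by ring.
pose s1 := take i b; pose s2 := drop i.+1 (take j b); pose s3 := drop j.+1 b.
pose c := nth a b i.
have tjE : take j b = s1 ++ c :: s2.
  rewrite (@dropat_nth _ a i (take j b)) ?size_take ?jb //.
  by rewrite take_takel 1?ltnW // nth_take.
have dE : drop i.+1 b = s2 ++ c :: s3.
  by rewrite {1}(dropat_nth a jb) drop_cat size_take jb -eij -/c -/s3 ltn_neqAle ij andbT;
   case: eqP => [e|//]; rewrite /s2 e drop_oversize ?size_take ?jb ?subnn.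
rewrite /dropat dE tjE -/s1 -/s3 -catA /= catA !skewD_insert catA -[in RHS]catA.
rewrite !big_cat /= !mulrA; congr (_ * _); last by rewrite catA.
rewrite [\prod_(k <- s2) skew x k c]prod_skewC size_drop size_take jb; ring.
Qed.

(** In each term of [skewD_expand] the entry at position [j] meets only the first variable, so
    [msum_dropat] separates it from the rest. *)
Lemma recP_expand l0 lb : odd (size lb) -> recP (l0 :: lb) setT =
  \sum_(j < size lb) (-1) ^+ j * (recP [:: l0; nth 0%N lb j] setT * recP (dropat j lb) setT).
Proof.
move=> ob; rewrite recP_setT.
transitivity (\sum_a \sum_(j < size lb) h l0 a * cross x setT a * ((-1) ^+ j *
   ((\sum_k h (nth 0%N lb j) k * cross x setT k * skew x a k) * msum (dropat j lb) skewD))).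
  apply: eq_bigr => a _; rewrite -mulr_sumr; congr (_ * _).
  transitivity (msum lb (fun b => \sum_(j < size lb) (-1) ^+ j *
       (skew x a (nth a b j) * skewD (dropat j b)))).
    by apply: eq_msum => b sb; rewrite -[LHS]/(skewD (a :: b)) skewD_expand sb.
  rewrite msum_sum; apply: eq_bigr => j _; rewrite mulr_msum; congr (_ * _).
  exact: msum_dropat.
rewrite exchange_big; apply: eq_bigr => j _; rewrite !recP_setT /= mulr_suml mulr_sumr.
apply: eq_bigr => a _; rewrite mulrCA !mulrA; congr (_ * _ * _).
by apply: eq_bigr => k _; rewrite big_seq1 big_nil !mulr1.
Qed.
End SetRecursion.

(** * Factorial powers: the Pieri rule and two-part functions *)

Lemma fact_powS (A : comNzRingType) (t : nat -> A) y k :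
  fact_pow t y k.+1 = fact_pow t y k * (y - t k).
Proof. by rewrite /fact_pow big_ord_recr. Qed.

(** Division of the factorial power by [y - z] with remainder; for [z = - x a] and [y = x b] the
    divisor is [x b + x a]. *)
Lemma fact_powB (A : comNzRingType) (t : nat -> A) y z l :
  fact_pow t y l - fact_pow t z l = (y - z) *
    \sum_(j < l) fact_pow t y j * \prod_(j.+1 <= i < l) (z - t i).
Proof.
elim: l => [|l IH]; first by rewrite /fact_pow !big_ord0 subrr mulr0.
rewrite big_ord_recr /= big_geq // mulr1 !fact_powS.
transitivity ((y - z) * ((\sum_(j < l) fact_pow t y j * \prod_(j.+1 <= i < l) (z - t i))
   * (z - t l) + fact_pow t y l)); last first.
  congr (_ * (_ + _)); rewrite mulr_suml; apply: eq_bigr => j _.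
  by rewrite [X in _ = _ * X]big_nat_recr ?mulrA.
by rewrite [RHS]mulrDr [X in _ = X + _]mulrA -IH; ring.
Qed.

Section FactorialRecursion.
Variables (K : fieldType) (I : finType) (x : I -> K) (t : nat -> K).
Hypothesis x_inj : injective x.
Hypothesis x_add : forall i j, x i + x j != 0.

Definition xpow (l : nat) (k : I) : K := fact_pow t (x k) l.
Local Notation P := (recP x xpow).

(** Once [k] is picked, the sum of the variables splits into [x k = (x k - t l) + t l], where
    [x k - t l] raises the exponent, and the sum over [A :\ k], to which induction applies. *)
Lemma recP_pieri la (A : {set I}) :
  (\sum_(k in A) x k) * P la A =
  \sum_(i < (size la).+1) P (incr_nth la i) A +
  (\sum_(i < size la) t (nth 0%N la i) + (odd (#|A| + size la))%:R * t 0%N) * P la A.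
Proof.
elim: la A => [|l la IH] A.
  rewrite big_ord1 big_ord0 /= addn0 add0r !mulr1.
  rewrite -(sum_mul_cross x_inj x_add) -(sum_cross x_inj x_add) mulr_suml -big_split /=.
  by apply: eq_bigr => k _; rewrite /xpow /fact_pow big_ord1; ring.
rewrite [X in _ = X + _]big_ord_recl [X in (X + _) * _]big_ord_recl /= mulr_sumr.
transitivity (\sum_(k in A) (xpow l.+1 k * cross x A k * P la (A :\ k)
   + \sum_(i < (size la).+1) xpow l k * cross x A k * P (incr_nth la i) (A :\ k)
   + (t l + \sum_(i < size la) t (nth 0%N la i) + (odd (#|A| + (size la).+1))%:R * t 0%N)
     * (xpow l k * cross x A k * P la (A :\ k)))).
  apply: eq_bigr => k kA; rewrite (big_setD1 k) //= mulrDl mulrCA.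
  have -> : (\sum_(i in A :\ k) x i) * (xpow l k * cross x A k * P la (A :\ k)) =
    xpow l k * cross x A k * ((\sum_(i in A :\ k) x i) * P la (A :\ k)) by ring.
  rewrite IH -mulr_sumr /xpow fact_powS.
  (* Picking one variable for one part preserves the parity. *)
  rewrite (_ : odd (#|A| + (size la).+1) = odd (#|A :\ k| + size la)); first by ring.
  by rewrite (cardsD1 k A) kA add1n addSn addnS /= negbK.
rewrite !big_split /= -mulr_sumr; congr (_ + _ + _).
by rewrite exchange_big; apply: eq_bigr.
Qed.

(** The factor [skew x a b] reduces [cross] to the variables other than [a], whose number is odd. *)
Lemma sum_cross_skew a : ~~ odd #|I| -> \sum_b cross x setT b * skew x a b = 1.
Proof.
move=> eI; transitivity (\sum_(b in [set~ a]) cross x [set~ a] b); last first.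
  rewrite sum_cross // (_ : odd _) //.
  by move: eI; rewrite -cardsT (cardsD1 a) inE setTD /= negbK.
rewrite [LHS](bigID (fun b => b \in [set~ a])) /= [X in _ + X]big1 ?addr0.
  apply: eq_bigr => b ba; rewrite (cross_setT x_inj x_add ba); congr (_ * _).
  by rewrite setCK big_set1.
by move=> b; rewrite !inE negbK => /eqP ->; rewrite /skew subrr mul0r mulr0.
Qed.

(** Division of [(x_b|t)^l] by [x b + x a]: the quotient cancels the denominator of [skew x a b] and
    leaves [x b - x a = (x b - t j) + (t j - x a)]; the remainder is free of [x b] and is summed by
    [sum_cross_skew]. *)
Lemma recP_two k l : ~~ odd #|I| -> P [:: k; l] setT =
  \sum_(j < l)
    ((\sum_b xpow j.+1 b * cross x setT b) *
     (\sum_a xpow k a * \prod_(j.+1 <= i < l) (- x a - t i) * cross x setT a)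
   + (\sum_b xpow j b * cross x setT b) *
     (\sum_a xpow k a * (t j - x a) * \prod_(j.+1 <= i < l) (- x a - t i)
        * cross x setT a))
  + \sum_a xpow k a * fact_pow t (- x a) l * cross x setT a.
Proof.
move=> eI; rewrite recP_setT //=.
transitivity (\sum_a (\sum_(j < l) (
   ((\sum_b xpow j.+1 b * cross x setT b) *
     (xpow k a * \prod_(j.+1 <= i < l) (- x a - t i) * cross x setT a)
   + (\sum_b xpow j b * cross x setT b) *
     (xpow k a * (t j - x a) * \prod_(j.+1 <= i < l) (- x a - t i)
        * cross x setT a)))
   + xpow k a * fact_pow t (- x a) l * cross x setT a)); last first.
  rewrite big_split /= exchange_big; congr (_ + _); apply: eq_bigr => j _.
  by rewrite big_split /= -!mulr_sumr.
apply: eq_bigr => a _.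
transitivity (xpow k a * cross x setT a * \sum_b cross x setT b *
   (\sum_(j < l) ((xpow j.+1 b + xpow j b * (t j - x a)) *
       \prod_(j.+1 <= i < l) (- x a - t i)) + fact_pow t (- x a) l * skew x a b)).
  congr (_ * _); apply: eq_bigr => b _; rewrite big_seq1 big_nil !mulr1.
  have := fact_powB t (x b) (- x a) l; rewrite opprK -/(xpow l b).
  move/eqP; rewrite subr_eq => /eqP ->; set S := \sum_(j < l) _.
  have -> : \sum_(j < l) ((xpow j.+1 b + xpow j b * (t j - x a)) *
      \prod_(j.+1 <= i < l) (- x a - t i)) = (x b - x a) * S.
    by rewrite mulr_sumr; apply: eq_bigr => j _; rewrite /xpow fact_powS; ring.
  by rewrite /skew; field; apply: x_add.
under eq_bigr do rewrite mulrDr.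
rewrite big_split /= mulrDr; congr (_ + _); last first.
  rewrite -[X in _ = X]mulr1 -[X in _ = _ * X](sum_cross_skew a eI) !mulr_sumr.
  by apply: eq_bigr => b _; ring.
under eq_bigr do rewrite mulr_sumr.
rewrite exchange_big mulr_sumr /=; apply: eq_bigr => j _.
rewrite !mulr_suml mulr_sumr -big_split /=; apply: eq_bigr => b _; ring.
Qed.
End FactorialRecursion.

(** * From sums over injections to the recursion *)

Lemma sum_ffunS (V : nmodType) (T : finType) n (Q : pred {ffun 'I_n.+1 -> T})
    (F : {ffun 'I_n.+1 -> T} -> V) :
  let cons k (f : {ffun 'I_n -> T}) := [ffun i => oapp f k (unlift ord0 i)] in
  \sum_(f | Q f) F f = \sum_k \sum_(f : {ffun 'I_n -> T} | Q (cons k f)) F (cons k f).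
Proof.
move=> cons; rewrite pair_big_dep /=.
rewrite (reindex (fun p : T * {ffun 'I_n -> T} => cons p.1 p.2)) //=.
exists (fun f => (f ord0, [ffun i => f (lift ord0 i)])) => [[k f]|f] _ /=.
  congr (_, _); first by rewrite ffunE unlift_none.
  by apply/ffunP => i; rewrite !ffunE liftK.
by apply/ffunP => i; rewrite ffunE; case: unliftP => [j ->|->] //=; rewrite ffunE.
Qed.

Lemma inj_sum_recP (K : fieldType) (t : nat -> K) la N (x : 'I_N -> K) :
  inj_sum t la x = recP x (xpow x t) la setT.
Proof.
(* A set of admissible values is introduced, so that the induction can remove the first value from
   it. *)
transitivity (\sum_(f : {ffun 'I_(size la) -> 'I_N} |
      injectiveb f && [forall i, f i \in [set: 'I_N]])
   (\prod_(i < size la) xpow x t (nth 0%N la i) (f i)) *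
   \prod_(i < size la) \prod_(k in [set: 'I_N] |
        [forall i' : 'I_(size la), (i' <= i)%N ==> (f i' != k)])
      ((x (f i) + x k) / (x (f i) - x k))).
  apply: eq_big => [f|f _]; last first.
    by congr (_ * _); apply: eq_bigr => i _; apply: eq_bigl => k; rewrite inE.
  by rewrite (_ : [forall i, _]) ?andbT //; apply/forallP => i; rewrite inE.
elim: la [set: 'I_N] => [|l la IH] A.
  rewrite (eq_bigr (fun=> 1)) => [|f _]; last by rewrite !big_ord0 mulr1.
  rewrite (eq_bigl predT) => [|f] /=; last first.
    apply/andP; split; first by apply/injectiveP => -[].
    by apply/forallP => -[].
  by rewrite sumr_const card_ffun !card_ord expn0.
rewrite sum_ffunS /= [RHS]big_mkcond /=; apply: eq_bigr => k _.
case: ifP => kA; last first.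
  rewrite big_pred0 // => f; apply/negbTE; rewrite negb_and; apply/orP; right.
  by apply/forallPn; exists ord0; rewrite ffunE unlift_none kA.
rewrite -IH mulr_sumr; apply: eq_big => [f|f /andP[/injectiveP fi /forallP fA]].
  apply/andP/andP => -[/injectiveP fi /forallP fA].
    split.
      apply/injectiveP => i j e; have := fi (lift ord0 i) (lift ord0 j).
      by rewrite !ffunE !liftK /= => /(_ e) /lift_inj.
    apply/forallP => i; rewrite !inE; apply/andP; split.
      apply/negP => /eqP e; have := fi (lift ord0 i) ord0.
      by rewrite !ffunE liftK unlift_none /= => /(_ e).
    by have := fA (lift ord0 i); rewrite ffunE liftK.
  split.
    apply/injectiveP => i j; rewrite !ffunE.
    case: unliftP => [i' ->|->]; case: unliftP => [j' ->|->] //= e.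
    - by rewrite (fi _ _ e).
    - by have := fA i'; rewrite e !inE eqxx.
    - by have := fA j'; rewrite -e !inE eqxx.
  apply/forallP => i; rewrite ffunE; case: unliftP => [j _|_] //=.
  by have := fA j; rewrite !inE => /andP[].
rewrite !big_ord_recl !ffunE unlift_none /= mulrACA; congr (_ * _ * (_ * _)).
- apply: eq_bigl => j; rewrite !inE andbC; congr (_ && _).
  apply/forallP/idP => [/(_ ord0)|jk i]; first by rewrite ffunE unlift_none /= eq_sym.
  apply/implyP; rewrite leqn0 => /eqP i0; rewrite ffunE.
  by rewrite (_ : i = ord0) ?unlift_none 1?eq_sym //; apply: val_inj.
- by apply: eq_bigr => i _; rewrite ffunE liftK.
apply: eq_bigr => i _; rewrite ffunE liftK /=; apply: eq_bigl => j; rewrite !inE.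
rewrite [(j != k) && _]andbC -andbA; congr (_ && _).
apply/forallP/andP => [H|[jk /forallP H] i'].
  split; first by have := H ord0; rewrite ffunE unlift_none /= eq_sym.
  by apply/forallP => i'; have := H (lift ord0 i'); rewrite ffunE liftK /= /bump !leq0n.
rewrite ffunE; case: unliftP => [i2 ->|->] /=; last by rewrite eq_sym.
exact: H.
Qed.

(** * Transfer to the projective limit *)

Section FactorialPlim.
Variables (R : idomainType) (chR : [pchar R] =i pred0).

Local Notation fracX m := {fraction {mpoly R[m.*2]}}.
Definition varX m (i : 'I_m.*2) : fracX m := FracField.tofrac 'X_i.
Definition constX m : {rmorphism R -> fracX m} :=
  (@FracField.tofrac {mpoly R[m.*2]} \o @mpolyC m.*2 R).
Definition tofracX m (f : plim R) : fracX m := FracField.tofrac (f m).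

Lemma varX_inj m : injective (@varX m).
Proof. by move=> i j /eqP; rewrite tofrac_eq => /eqP /mpolyX_inj. Qed.

Lemma varX_add m i j : @varX m i + varX j != 0.
Proof.
rewrite -rmorphD tofrac_eq0; apply/eqP => /(congr1 (mcoeff U_(i))).
rewrite mcoeffD !mcoeffX mcoeff0 eqxx; case: eqP => _ /eqP; last first.
  by rewrite addr0 oner_eq0.
by rewrite -natrD (negPf (natr_neq0 chR 1)).
Qed.

Lemma tofracX_inj f g : (forall m, tofracX m f = tofracX m g) -> f = g.
Proof.
by move=> e; apply: plim_ext => m; apply/eqP; rewrite -tofrac_eq; apply/eqP/e.
Qed.

Lemma tofracXD m f g : tofracX m (f + g) = tofracX m f + tofracX m g.
Proof. by rewrite /tofracX /= rmorphD. Qed.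
Lemma tofracXM m f g : tofracX m (f * g) = tofracX m f * tofracX m g.
Proof. by rewrite /tofracX /= rmorphM. Qed.
Lemma tofracXZ m c f : tofracX m (c *: f) = constX m c * tofracX m f.
Proof. by rewrite /tofracX /= -mul_mpolyC rmorphM. Qed.
Lemma tofracX1 m : tofracX m 1 = 1.
Proof. exact: rmorph1. Qed.
Lemma tofracX0 m : tofracX m 0 = 0.
Proof. exact: rmorph0. Qed.
Lemma tofracX_sum m (J : Type) (r : seq J) (Q : pred J) (F : J -> plim R) :
  tofracX m (\sum_(j <- r | Q j) F j) = \sum_(j <- r | Q j) tofracX m (F j).
Proof. by apply: big_morph => [f g|]; rewrite ?tofracXD ?tofracX0. Qed.

(** Together with [tofracX_inj] this transfers identities of [recP], checked in the fraction field
    for each even number of variables. *)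
Lemma tofracX_factP (t : nat -> R) la m :
  tofracX m (factP chR t la) =
  recP (@varX m) (xpow (@varX m) (constX m \o t)) la setT.
Proof.
rewrite -inj_sum_recP /tofracX /= factP_fin_eval //.
by move=> i j /varX_inj.
Qed.

Lemma even_card_double m : ~~ odd #|'I_m.*2|.
Proof. by rewrite card_ord odd_double. Qed.

(* [lin_factP p] is the image of [p] under the linear map that sends [(y|t)^k] *)
(* to [P_k(x|t)] for every [t]; in particular it sends [y^k] to [P_k(x|0)].    *)
Definition lin_factP (p : {poly R}) : plim R :=
  \sum_(i < size p) p`_i *: factP chR (fun=> 0) [:: val i].

Definition evalX m (a : 'I_m.*2) : {rmorphism {poly R} -> fracX m} :=
  (horner_eval (varX a) \o map_poly (constX m)).

Lemma evalXX m a : @evalX m a 'X = varX a.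
Proof. by rewrite /= map_polyX /horner_eval hornerX. Qed.
Lemma evalXC m a c : @evalX m a c%:P = constX m c.
Proof. by rewrite /= map_polyC /horner_eval hornerC. Qed.

Lemma tofracX_lin m p : tofracX m (lin_factP p) =
  \sum_a evalX a p * cross (@varX m) setT a.
Proof.
rewrite tofracX_sum.
transitivity (\sum_(i < size p) \sum_a constX m p`_i * varX a ^+ i * cross (@varX m) setT a).
  apply: eq_bigr => i _; rewrite tofracXZ tofracX_factP /= mulr_sumr.
  apply: eq_big => [a|a _]; first by rewrite inE.
  rewrite mulr1 mulrA /xpow /fact_pow; congr (_ * _ * _).
  by under eq_bigr do rewrite /= rmorph0 subr0; rewrite prodr_const card_ord.
rewrite exchange_big; apply: eq_bigr => a _; rewrite -mulr_suml; congr (_ * _).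
rewrite /= /horner_eval (@horner_coef_wide _ (size p)).
  by apply: eq_bigr => i _; rewrite coef_map.
by rewrite size_poly.
Qed.

Lemma lin_factP_sum (n : nat) (c : 'I_n -> R) (p : 'I_n -> {poly R}) :
  lin_factP (\sum_i c i *: p i) = \sum_i c i *: lin_factP (p i).
Proof.
apply: tofracX_inj => m; rewrite tofracX_lin tofracX_sum.
under [RHS]eq_bigr do rewrite tofracXZ tofracX_lin mulr_sumr.
rewrite exchange_big; apply: eq_bigr => a _; rewrite rmorph_sum mulr_suml.
by apply: eq_bigr => i _; rewrite -mul_polyC rmorphM evalXC mulrA.
Qed.

Variable t : nat -> R.
Local Notation P := (factP chR t).
Local Notation tX m := (constX m \o t).

Definition polypow (k : nat) : {poly R} := \prod_(i < k) ('X - (t i)%:P).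

Lemma evalX_polypow m a k : @evalX m a (polypow k) = xpow (@varX m) (tX m) k a.
Proof. by rewrite rmorph_prod; apply: eq_bigr => i _; rewrite rmorphB evalXX evalXC. Qed.

Lemma lin_factP_pow k : lin_factP (polypow k) = P [:: k].
Proof.
apply: tofracX_inj => m; rewrite tofracX_lin tofracX_factP [RHS]/=.
by apply: eq_big => [a|a _]; rewrite ?inE // evalX_polypow mulr1.
Qed.

Lemma factP_nil : P [::] = 1.
Proof. by apply: tofracX_inj => m; rewrite tofracX_factP tofracX1. Qed.

(** A single part 0 differs from the empty list: over an even number of variables [cross] sums to
    0. *)
Lemma factP_0 : P [:: 0%N] = 0.
Proof.
apply: tofracX_inj => m; rewrite tofracX_factP tofracX0 /=.
transitivity (\sum_(k in [set: 'I_m.*2]) cross (@varX m) setT k).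
  by apply: eq_bigr => a _; rewrite /xpow /fact_pow big_ord0 mul1r mulr1.
rewrite sum_cross ?cardsT ?card_ord ?odd_double //; first exact: varX_inj.
exact: varX_add.
Qed.

Lemma factP_rcons0 la : odd (size la) -> P (rcons la 0%N) = P la.
Proof.
move=> ol; apply: tofracX_inj => m; rewrite !tofracX_factP recP_rcons0 //.
- exact: varX_inj.
- exact: varX_add.
- by move=> k; rewrite /xpow /fact_pow big_ord0.
- by rewrite cardsT card_ord oddD odd_double ol.
Qed.

Lemma factP_dup s1 a s2 : P (s1 ++ a :: a :: s2) = 0.
Proof.
apply: tofracX_inj => m; rewrite !tofracX_factP tofracX0 recP_dup //.
  exact: varX_inj.
exact: varX_add.
Qed.

Lemma factP_expand l0 lb : odd (size lb) -> P (l0 :: lb) =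
  \sum_(j < size lb) (-1) ^+ j *: (P [:: l0; nth 0%N lb j] * P (dropat j lb)).
Proof.
move=> ob; apply: tofracX_inj => m; rewrite !tofracX_factP recP_expand //; last first.
- exact: varX_add.
- exact: varX_inj.
rewrite tofracX_sum; apply: eq_bigr => j _.
by rewrite tofracXZ tofracXM !tofracX_factP rmorphXn rmorphN1.
Qed.

(** The correction by [t 0] drops out since [cross] sums to 0 over an even number of variables. *)
Lemma factP_one m : tofracX m (P [:: 1%N]) = \sum_a @varX m a.
Proof.
have xi := @varX_inj m; have xa := @varX_add m.
have := sum_mul_cross xi xa setT; have := sum_cross xi xa setT.
rewrite cardsT card_ord odd_double => s0 s1.
rewrite tofracX_factP /=; transitivity (\sum_(a in setT) @varX m a); last first.
  by apply: eq_bigl => a; rewrite inE.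
rewrite -s1 -[RHS]subr0 -[X in _ - X](mulr0 (tX m 0%N)) -[X in _ * X]s0 mulr_sumr -sumrB.
by apply: eq_bigr => a _; rewrite /xpow /fact_pow big_ord1 /=; ring.
Qed.

(** For odd length the bound exceeds the length by one, and the default value of [nth] supplies the
    extra part 0. *)
Lemma sum_nth_double la :
  \sum_(i < (size la).+1./2.*2) t (nth 0%N la i) =
  \sum_(i < size la) t (nth 0%N la i) + (odd (size la))%:R * t 0%N.
Proof.
have -> : (size la).+1./2.*2 = (size la + odd (size la))%N.
  by rewrite -uphalfE uphalf_half doubleD -[in RHS](odd_double_half (size la)); case: (odd _); lia.
case: (odd _); last by rewrite addn0 mul0r addr0.
by rewrite addn1 big_ord_recr /= mul1r nth_default.
Qed.

Lemma factP_pieri la : P [:: 1%N] * P la =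
  \sum_(i < (size la).+1) P (incr_nth la i)
  + (\sum_(i < (size la).+1./2.*2) t (nth 0%N la i)) *: P la.
Proof.
apply: tofracX_inj => m; rewrite tofracXM factP_one tofracXD tofracXZ tofracX_sum.
have -> : \sum_a @varX m a = \sum_(a in setT) @varX m a.
  by apply: eq_bigl => a; rewrite inE.
rewrite tofracX_factP recP_pieri; [|exact: varX_inj|exact: varX_add].
congr (_ + _ * _); first by apply: eq_bigr => i _; rewrite tofracX_factP.
rewrite sum_nth_double rmorphD rmorph_sum rmorphM rmorph_nat; congr (_ + _%:R * _).
by rewrite cardsT card_ord oddD odd_double.
Qed.

(** * Two-part functions in terms of one-part functions *)

Definition tailpow (j l : nat) : {poly R} := \prod_(j.+1 <= i < l) (- 'X - (t i)%:P).
Definition negpow (l : nat) : {poly R} := \prod_(i < l) (- 'X - (t i)%:P).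

(** Each sum over one variable in [recP_two] is a one-part function or [lin_factP] of a polynomial
    in the variable of the first part. *)
Lemma factP_two k l : P [:: k; l] =
  \sum_(j < l) (P [:: j.+1] * lin_factP (polypow k * tailpow j l)
     + P [:: j : nat] * lin_factP (polypow k * (((t j)%:P - 'X) * tailpow j l)))
  + lin_factP (polypow k * negpow l).
Proof.
apply: tofracX_inj => m; rewrite tofracX_factP recP_two; last exact: even_card_double;
 [|exact: varX_inj|exact: varX_add].
have PE i : tofracX m (P [:: i]) =
    \sum_b xpow (@varX m) (tX m) i b * cross (@varX m) setT b.
  by rewrite -lin_factP_pow tofracX_lin; apply: eq_bigr => a _; rewrite evalX_polypow.
have evN a i : evalX a (- 'X - (t i)%:P) = - varX a - tX m i.
  by rewrite rmorphB rmorphN evalXX evalXC.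
have evT a j : evalX a (tailpow j l) = \prod_(j.+1 <= i < l) (- varX a - tX m i).
  by rewrite rmorph_prod; apply: eq_bigr => i _; rewrite evN.
rewrite tofracXD tofracX_sum; congr (_ + _).
  apply: eq_bigr => j _; rewrite tofracXD !tofracXM !PE !tofracX_lin.
  congr (_ * _ + _ * _); apply: eq_bigr => a _; rewrite !rmorphM evalX_polypow evT //.
  by rewrite rmorphB evalXX evalXC mulrA.
rewrite tofracX_lin; apply: eq_bigr => a _; rewrite rmorphM evalX_polypow.
congr (_ * _ * _); rewrite rmorph_prod; apply: eq_bigr => i _; exact/esym/evN.
Qed.

Lemma polypowD k d : polypow (k + d) = polypow k * \prod_(i < d) ('X - (t (k + i))%:P).
Proof. by rewrite /polypow big_split_ord. Qed.

(** Leading terms are split off one by one. The top coefficient is recorded because it becomes the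
    coefficient of [P_(2n)] in [eqmod_two]. *)
Lemma polypow_span k d (h : {poly R}) : (size h <= d.+1)%N ->
  exists2 c : 'I_d.+1 -> R, c ord_max = h`_d &
    polypow k * h = \sum_i c i *: polypow (k + i).
Proof.
elim: d h => [|d IH] h sh.
  exists (fun=> h`_0) => //; rewrite big_ord1 addn0 [in LHS](size1_polyC sh).
  by rewrite mulrC mul_polyC.
pose g : {poly R} := \prod_(i < d.+1) ('X - (t (k + i))%:P).
have sg : size g = d.+2.
  by rewrite /g (size_prod_XsubC (index_enum 'I_d.+1)) -[index_enum _]enumT size_enum_ord.
have g_monic : g \is monic by apply: monic_prod_XsubC.
have gd : g`_d.+1 = 1 by move/monicP: g_monic; rewrite lead_coefE sg.
have [|c _ cE] := IH (h - h`_d.+1 *: g).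
  apply/leq_sizeP => j; rewrite leq_eqVlt coefB coefZ => /orP[/eqP <-|dj].
    by rewrite gd mulr1 subrr.
  rewrite (nth_default _ (leq_trans sh dj)) [g`_j]nth_default ?sg //.
  by rewrite mulr0 subrr.
(* [insub] fails exactly at the last index, which receives the leading coefficient. *)
exists (fun i => oapp c h`_d.+1 (insub (val i))).
  by rewrite insubF //= ltnn.
rewrite big_ord_recr /= insubF ?ltnn //= -[h in LHS](subrK (h`_d.+1 *: g)) mulrDr cE.
congr (_ + _); last by rewrite -scalerAr polypowD.
by apply: eq_bigr => i _; rewrite valK.
Qed.

Lemma lin_factP_span k d (h : {poly R}) : (size h <= d.+1)%N ->
  exists2 c : 'I_d.+1 -> R, c ord_max = h`_d &
    lin_factP (polypow k * h) = \sum_i c i *: P [:: (k + i)%N].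
Proof.
move=> sh; have [c cd cE] := polypow_span k sh; exists c => //.
by rewrite cE lin_factP_sum; apply: eq_bigr => i _; rewrite lin_factP_pow.
Qed.

Lemma prod_NXsubC (J : Type) (r : seq J) (y : J -> R) :
  \prod_(i <- r) (- 'X - (y i)%:P) =
  (-1) ^+ size r *: \prod_(i <- r) ('X - (- y i)%:P).
Proof.
elim: r => [|i r IH]; first by rewrite !big_nil scale1r.
by rewrite !big_cons IH /= -!mul_polyC !rmorphXn !rmorphN1 exprS polyCN; ring.
Qed.

Lemma size_prod_NXsubC (J : Type) (r : seq J) (y : J -> R) :
  size (\prod_(i <- r) (- 'X - (y i)%:P)) = (size r).+1.
Proof.
by rewrite prod_NXsubC size_scale ?signr_eq0 // (size_prod_XsubC r (fun i => - y i)).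
Qed.

Lemma size_tailpow j l : (j < l)%N -> size (tailpow j l) = (l - j)%N.
Proof. by move=> jl; rewrite size_prod_NXsubC size_iota; lia. Qed.

Lemma size_negpow l : size (negpow l) = l.+1.
Proof. by rewrite size_prod_NXsubC -[index_enum _]enumT size_enum_ord. Qed.

Lemma coef_negpow l : (negpow l)`_l = (-1) ^+ l.
Proof.
rewrite /negpow prod_NXsubC -[index_enum _]enumT size_enum_ord coefZ.
have /monicP := monic_prod_XsubC (enum 'I_l) predT (fun i => - t i).
by rewrite lead_coefE size_prod_XsubC size_enum_ord /= => ->; rewrite mulr1.
Qed.
End FactorialPlim.

(** * Boxes added below the first row *)

(** Such a box can violate strictness only by making its row as long as the row above; [factP_dup]
    then gives 0. *)
Lemma incr_nth_strict_or_dup la i : strict_part la -> (0 < i <= size la)%N ->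
  strict_part (incr_nth la i) \/
  exists s1 a s2, incr_nth la i = s1 ++ a :: a :: s2.
Proof.
elim: la i => [|a la IH] [|i] //= sla il.
have [i0|i0] := posnP i.
  rewrite i0; case: la IH sla il => [|b la] IH sla il /=.
    have a0 : (0 < a)%N by move: sla; rewrite /strict_part /= inE lt0n eq_sym.
    have [->|a1] := eqVneq a 1%N; first by right; exists [::], 1%N, [::].
    left; rewrite /strict_part /= !inE; lia.
  move: sla; rewrite /strict_part /= !inE !negb_or => /and3P[/andP[ba pb] a0 /andP[b0 la0]].
  have [->|a1] := eqVneq a b.+1; first by right; exists [::], b.+1, la.
  left; rewrite la0 a0 /= (path_le _ _ pb) /=; last 2 first.
  - by move=> u v w /=; lia.
  - by rewrite /=.
  by move: ba a1; rewrite andbT; lia.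
have sl : strict_part la.
  move: sla; rewrite /strict_part /= inE negb_or => /and3P[/path_sorted -> _ ->].
  by [].
have [|s|[s1 [c [s2 ->]]]] := IH i sl; first by rewrite i0.
  left; case: i i0 s il {IH} => // i _; case: la sla sl => // b la sla sl s il.
  move: sla s; rewrite /strict_part /= !inE !negb_or.
  by move=> /and3P[/andP[-> _] -> _] /andP[-> ->].
by right; exists (a :: s1), c, s2.
Qed.

(** * The subalgebra, the ideal and reduction of a first row [n + 1] *)

Section QuantumRing.
Variable n : nat.
Local Notation lin := (lin_factP (@pchar_Sq n)).
Local Notation pw := (polypow (tvar n)).

Lemma in_subalgD (f g : plim (Sq n)) : in_subalg f -> in_subalg g -> in_subalg (f + g).
Proof. by move=> [p ->] [q ->]; exists (p + q); rewrite rmorphD. Qed.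

Lemma in_subalgM (f g : plim (Sq n)) : in_subalg f -> in_subalg g -> in_subalg (f * g).
Proof. by move=> [p ->] [q ->]; exists (p * q); rewrite rmorphM. Qed.

Lemma in_subalgZ c (f : plim (Sq n)) : in_subalg f -> in_subalg (c *: f).
Proof. by move=> [p ->]; exists (c *: p); rewrite mmapZ /= mulr_algl. Qed.

Lemma in_subalg0 : in_subalg (0 : plim (Sq n)).
Proof. by exists 0; rewrite rmorph0. Qed.

Lemma in_subalg1 : in_subalg (1 : plim (Sq n)).
Proof. by exists 1; rewrite rmorph1. Qed.

Lemma in_subalg_sum (J : Type) (r : seq J) (Q : pred J) (F : J -> plim (Sq n)) :
  (forall j, Q j -> in_subalg (F j)) -> in_subalg (\sum_(j <- r | Q j) F j).
Proof. by move=> FP; apply: big_ind => //; [exact: in_subalg0|exact: in_subalgD]. Qed.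

Lemma in_subalg_row i : (i <= n.*2)%N -> in_subalg (Pt n [:: i]).
Proof.
case: i => [|i] i2n; first by rewrite /Pt factP_0; apply: in_subalg0.
by exists 'X_(Ordinal i2n); rewrite mmapX mmap1U.
Qed.

Lemma in_ideal0 : in_ideal (0 : plim (Sq n)).
Proof.
exists (fun=> 0); split=> [i|]; first exact: in_subalg0.
by rewrite big1 // => i _; rewrite mul0r.
Qed.

Lemma in_idealD (f g : plim (Sq n)) : in_ideal f -> in_ideal g -> in_ideal (f + g).
Proof.
move=> [a [aP ->]] [b [bP ->]]; exists (fun i => a i + b i); split=> [i|].
  exact: in_subalgD.
by rewrite -big_split; apply: eq_bigr => i _; rewrite mulrDl.
Qed.

Lemma in_idealMl (f g : plim (Sq n)) : in_subalg f -> in_ideal g -> in_ideal (f * g).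
Proof.
move=> fP [b [bP ->]]; exists (fun i => f * b i); split=> [i|].
  exact: in_subalgM.
by rewrite mulr_sumr; apply: eq_bigr => i _; rewrite mulrA.
Qed.

Lemma in_idealZ c (f : plim (Sq n)) : in_ideal f -> in_ideal (c *: f).
Proof.
by move=> fI; rewrite -mulr_algl; apply/in_idealMl/fI/in_subalgZ/in_subalg1.
Qed.

Lemma in_ideal_sum (J : Type) (r : seq J) (Q : pred J) (F : J -> plim (Sq n)) :
  (forall j, Q j -> in_ideal (F j)) -> in_ideal (\sum_(j <- r | Q j) F j).
Proof. by move=> FP; apply: big_ind => //; [exact: in_ideal0|exact: in_idealD]. Qed.

Lemma in_ideal_gen i : in_ideal (@ideal_gen n i).
Proof.
exists (fun j => if j == i then 1 else 0); split=> [j|].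
  by case: ifP => _; [exact: in_subalg1|exact: in_subalg0].
rewrite (bigD1 i) //= eqxx mul1r big1 ?addr0 // => j /negPf ->.
by rewrite mul0r.
Qed.

Lemma in_ideal_row i : (n < i < n.*2)%N -> in_ideal (Pt n [:: i]).
Proof.
move=> iP; have i1n : (i - n.+1 < n)%N by lia.
have := in_ideal_gen (Ordinal i1n); rewrite /ideal_gen /=.
rewrite (_ : (_ == _) = false) ?addr0; last by apply/negbTE; lia.
by rewrite (_ : (n + _)%N = i) //; lia.
Qed.

Lemma in_ideal_row_double : (0 < n)%N ->
  in_ideal (Pt n [:: n.*2] + ((-1) ^+ n * qvar n)%:A).
Proof.
move=> n0; have n1n : (n.-1 < n)%N by lia.
have := in_ideal_gen (Ordinal n1n); rewrite /ideal_gen /= prednK // eqxx.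
by rewrite addnn.
Qed.

Lemma in_subalg_lin k l (h : {poly Sq n}) : (k + l <= n.*2)%N -> (size h <= l.+1)%N ->
  in_subalg (lin (pw k * h)).
Proof.
move=> kl sh; have [c _ ->] := lin_factP_span (@pchar_Sq n) (tvar n) k sh.
apply: in_subalg_sum => i _; apply/in_subalgZ/in_subalg_row.
by have := ltn_ord i; lia.
Qed.

(** In degree at most [n - 2] the expansion uses only the rows [n + 1] to [2n - 1], which are
    generators. *)
Lemma in_ideal_lin (h : {poly Sq n}) : (size h < n)%N -> in_ideal (lin (pw n.+1 * h)).
Proof.
case: (ltnP 1 n) => [n1|n1 sh]; last first.
  have /eqP : size h == 0%N by lia.
  move/eqP; rewrite size_poly_eq0 => /eqP ->.
  by rewrite mulr0 /lin_factP size_poly0 big_ord0; apply: in_ideal0.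
move=> sh; have sh' : (size h <= n.-2.+1)%N by lia.
have [c _ ->] := lin_factP_span (@pchar_Sq n) (tvar n) n.+1 sh'.
apply: in_ideal_sum => i _; apply/in_idealZ/in_ideal_row.
by have := ltn_ord i; lia.
Qed.

Lemma size_mul_tailpow j l : (j < l)%N ->
  (size (((tvar n j)%:P - 'X) * tailpow (tvar n) j l)%R <= (l - j).+1)%N.
Proof.
move=> jl; apply: (leq_trans (size_polyMleq _ _)).
by rewrite size_tailpow // -opprB size_polyN size_XsubC.
Qed.

Lemma in_subalg_two k l : (k + l <= n.*2)%N -> in_subalg (Pt n [:: k; l]).
Proof.
move=> kl; rewrite /Pt factP_two; apply: in_subalgD; last first.
  by apply: (@in_subalg_lin _ l) => //; rewrite size_negpow.
apply: in_subalg_sum => j _; have jl := ltn_ord j.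
apply: in_subalgD; apply: in_subalgM.
- by apply: in_subalg_row; lia.
- by apply: (@in_subalg_lin _ l) => //; rewrite size_tailpow //; lia.
- by apply: in_subalg_row; rewrite /=; lia.
- by apply: (@in_subalg_lin _ l) => //; apply: (leq_trans (size_mul_tailpow jl)); lia.
Qed.

(** Induction on the length by expansion along the first row: two parts at most [n] add up to at
    most [2n], as [in_subalg_two] requires. *)
Lemma in_subalg_Pt la : all (leq^~ n) la -> in_subalg (Pt n la).
Proof.
have [N] := ubnP (size la); elim: N la => // N IH [|l0 lb] /= sN lan.
  by rewrite /Pt factP_nil; apply: in_subalg1.
(* The expansion needs a tail of odd length, so [lc] is [lb] or [lb] with a 0 appended. *)
have H lc : odd (size lc) -> (size lc <= (size lb).+1)%N -> all (leq^~ n) lc ->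
    in_subalg (Pt n (l0 :: lc)).
  move=> oc sc lcn; rewrite /Pt factP_expand //; apply: in_subalg_sum => j _.
  apply/in_subalgZ/in_subalgM; last first.
    by apply: IH; [rewrite size_dropat //; lia | apply: all_dropat].
  apply: in_subalg_two; rewrite -addnn; apply: leq_add; first by case/andP: lan.
  exact: (allP lcn _ (mem_nth _ _)).
have [ob|eb] := boolP (odd (size lb)); first by apply: H => //; case/andP: lan.
rewrite /Pt -factP_rcons0 //= -/(Pt n (l0 :: rcons lb 0%N)).
by apply: H; rewrite ?size_rcons // all_rcons; case/andP: lan.
Qed.

(** The surviving polynomial factors in [factP_two] have degree at most [n - 2], except [negpow] for
    [m = n - 1], whose top term yields [(-1)^m P_(2n)]. *)
Lemma eqmod_two m : (m < n)%N -> eqmod_ideal (Pt n [:: n.+1; m])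
  (if m == n.-1 then (qvar n)%:A else 0).
Proof.
move=> mn; rewrite /eqmod_ideal /Pt factP_two -addrA; apply: in_idealD.
  apply: in_ideal_sum => j _; have jm := ltn_ord j; apply: in_idealD.
    apply: in_idealMl; first by apply: in_subalg_row; lia.
    by apply: in_ideal_lin; rewrite size_tailpow //; lia.
  (* For [j = 0] the polynomial factor may have degree [n - 1], but it is multiplied by
     [P_(0) = 0]. *)
  have [j0|j0] := posnP j.
    by rewrite j0 factP_0 mul0r; apply: in_ideal0.
  apply: in_idealMl; first by apply: in_subalg_row; lia.
  by apply: in_ideal_lin; apply: (leq_ltn_trans (size_mul_tailpow jm)); lia.
have [mE|mE] := eqVneq; last first.
  by rewrite subr0; apply: in_ideal_lin; rewrite size_negpow; move/eqP: mE; lia.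
have sN : (size (negpow (tvar n) m) <= m.+1)%N by rewrite size_negpow.
have [c] := lin_factP_span (@pchar_Sq n) (tvar n) n.+1 sN.
rewrite coef_negpow => cm ->; rewrite big_ord_recr /= cm -addrA; apply: in_idealD.
  apply: in_ideal_sum => i _; apply/in_idealZ/in_ideal_row.
  by have := ltn_ord i; lia.
have -> : (n.+1 + m)%N = n.*2 by lia.
(* As [m + n = 2n - 1] is odd, the signs combine to [+q]. *)
have -> : (-1) ^+ m *: factP (@pchar_Sq n) (tvar n) [:: n.*2] - (qvar n)%:A =
    (-1) ^+ m *: (Pt n [:: n.*2] + ((-1) ^+ n * qvar n)%:A).
  rewrite scalerDr scalerA mulrA -exprD; congr (_ + _).
  rewrite (_ : (m + n)%N = m.*2.+1); last by lia.
  by rewrite exprS -signr_odd odd_double expr0 mulr1 mulN1r scaleNr.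
by apply/in_idealZ/in_ideal_row_double; lia.
Qed.

(** Only the first entry of [lb] can equal [n - 1]; by [eqmod_two] the other terms of the expansion
    lie in the ideal. *)
Lemma eqmod_first_row lb : path gtn n lb -> 0%N \notin n :: lb ->
  eqmod_ideal (Pt n (n.+1 :: lb))
    (if nth 0%N lb 0 == n.-1 then qvar n *: Pt n (behead lb) else 0).
Proof.
move=> plb lb0.
have H lc : odd (size lc) -> path gtn n lc -> eqmod_ideal (Pt n (n.+1 :: lc))
    (if nth 0%N lc 0 == n.-1 then qvar n *: Pt n (behead lc) else 0).
  case: lc => // l lc oc pl.
  have gtn_tr : transitive gtn by move=> a b c /=; lia.
  have lt_nth j : (j <= size lc)%N -> (nth 0%N (l :: lc) j < n)%N.
    move=> jl; apply: (allP (order_path_min gtn_tr pl)).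
    by rewrite mem_nth.
  have lt_nth1 j : (j < size lc)%N -> (nth 0%N lc j < l)%N.
    move=> jl; have /andP[_ pl'] : (l < n)%N && path gtn l lc by [].
    by apply: (allP (order_path_min gtn_tr pl')); rewrite mem_nth.
  have lcn : all (leq^~ n) (l :: lc).
    by apply/(all_nthP 0%N) => j jl; apply/ltnW/lt_nth.
  rewrite /eqmod_ideal /Pt factP_expand // big_ord_recl /= expr0 scale1r addrAC.
  rewrite -!/(Pt n _); apply: in_idealD; last first.
    apply: in_ideal_sum => j _; apply: in_idealZ; rewrite mulrC.
    apply: in_idealMl; first by apply/in_subalg_Pt/all_dropat.
    have := eqmod_two (lt_nth j.+1 (ltn_ord j)); rewrite /= (_ : (_ == _) = false).
      by rewrite /eqmod_ideal subr0.
    have := lt_nth1 j (ltn_ord j); have := lt_nth 0%N isT => /= h1 h2.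
    by apply/eqP; lia.
  have dE : dropat 0 (l :: lc) = lc by rewrite /dropat /= drop0.
  rewrite dE.
  have := eqmod_two (lt_nth 0%N isT); rewrite /eqmod_ideal /=.
  have lcP : in_subalg (Pt n lc) by apply: in_subalg_Pt; case/andP: lcn.
  move/(in_idealMl lcP); rewrite mulrBr mulrC; case: eqP => _; last by rewrite mulr0.
  by rewrite mulr_algr.
have [ob|eb] := boolP (odd (size lb)); first exact: H.
rewrite /Pt -factP_rcons0 //= -/(Pt n (n.+1 :: rcons lb 0%N)).
have prc : path gtn n (rcons lb 0%N).
  by rewrite rcons_path plb /= lt0n; apply: contraNneq lb0 => <-; apply: mem_last.
have := H (rcons lb 0%N); rewrite size_rcons /= eb => /(_ isT prc).
(* For empty [lb] the appended 0 agrees with the default of [nth]; this gives the [q]-term when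
   [n = 1]. *)
case: lb plb lb0 eb {prc} => [|l lb] //= plb lb0 eb.
by rewrite /Pt factP_rcons0 //; move: eb; rewrite negbK.
Qed.

End QuantumRing.

(** * The Pieri rule modulo the ideal *)

Theorem theorem4p1 (n : nat) (la : seq nat) (n_gt0 : (0 < n)%N)
    (la_SP : SP n la) :
  in_subalg (Pt n la) /\
  eqmod_ideal (Pt n [:: 1%N] * Pt n la)
    (\sum_(mu <- add_box la | SP n mu) Pt n mu
     + (\sum_(i < ((size la).+1)./2.*2) tvar n (nth 0%N la i)) *: Pt n la
     + (if (nth 0%N la 0 == n) && (nth 0%N la 1 == n.-1)
        then qvar n *: Pt n (drop 2 la) else 0)).
Proof.
have /andP[la_strict la_n] := la_SP.
have /andP[la_sorted la_0] := la_strict.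
split.
  apply: in_subalg_Pt; case: la la_n la_sorted {la_SP la_strict la_0} => //= a la an pa.
  rewrite an; have gtn_tr : transitive gtn by move=> b c d /=; lia.
  by apply: sub_all (order_path_min gtn_tr pa) => b /= ba; lia.
rewrite /eqmod_ideal {1}/Pt {1}/Pt factP_pieri -/(Pt n la).
set C := (X in X *: Pt n la); set Q := (X in _ - (_ + X)).
rewrite /add_box big_map.
have -> : \sum_(i <- iota 0 (size la).+1 | SP n (incr_nth la i)) Pt n (incr_nth la i)
  = \sum_(i < (size la).+1 | SP n (incr_nth la i)) Pt n (incr_nth la i).
  by rewrite -(big_mkord (fun i => SP n (incr_nth la i)) (fun i => Pt n (incr_nth la i)))
     /index_iota subn0.
rewrite (bigID (fun i : 'I_(size la).+1 => SP n (incr_nth la i))) /= -!/(Pt n _).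
set S1 := (X in X + _ + _ - _); set S2 := (X in _ + X + _ - _).
have -> : S1 + S2 + C *: Pt n la - (S1 + C *: Pt n la + Q) = S2 - Q by ring.
(* A box below the first row keeps the first part, so it stays in [SP n] or gives a repeated part
   and hence 0. *)
have {S1} -> : S2 = if SP n (incr_nth la 0) then 0 else Pt n (incr_nth la 0).
  rewrite /S2 big_mkcond big_ord_recl /= [X in _ + X]big1 ?addr0; first by case: SP.
  move=> i _; case: ifPn => // nSP; have iP : (0 < bump 0 i <= size la)%N.
    by rewrite /bump /=; have := ltn_ord i; lia.
  have [s|[s1 [a [s2 ->]]]] := incr_nth_strict_or_dup la_strict iP; last first.
    by rewrite /Pt factP_dup.
  by case/negP: nSP; rewrite /SP s nth_incr_nth.
rewrite /Q; case: la la_strict la_n la_sorted la_0 {S2 C Q la_SP} => [|a lb].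
  move=> _ _ _ _; rewrite /= /SP /strict_part /= n_gt0 eq_sym (gtn_eqF n_gt0) /= subr0.
  exact: in_ideal0.
move=> sp /= an plb nz.
have sS : strict_part (a.+1 :: lb).
  move: nz; rewrite /strict_part /= !inE !negb_or => /andP[_ ->]; rewrite !andbT.
  by apply: path_le plb; [move=> u v w /=; lia | rewrite /=].
rewrite /SP sS /=; case: ltnP => ha.
  by rewrite (ltn_eqF ha) /= subr0; apply: in_ideal0.
(* The box now makes the first part [n + 1], and [eqmod_first_row] reduces this term to the
   [q]-term. *)
have aE : a = n by apply/eqP; rewrite eqn_leq an.
rewrite aE eqxx /=; rewrite aE in plb nz.
have := eqmod_first_row plb nz; rewrite /eqmod_ideal.
by case: lb {sp plb nz sS} => [|b lb] /=; rewrite ?drop0.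
Qed.
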